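(* Let $a,b>0$, and for $i\in\{0,1\}$, $j\in\{0,1,2,3\}$ let $\mathcal R_{ij}$ be the set of open rectangles that can move around the corner in the corridor $\mathcal C_{ij}$. For each $(i,j)$ the maximum area of a rectangle in $\mathcal R_{ij}$ is $ab$. Moreover, the maximum area rectangles from the set: (i) $\mathcal R_{0i}$, $i=0,1,2$, are exactly those with side lengths $ab/d$ and $d$, where $0<d\le a\wedge b$; (ii) $\mathcal R_{03}$ are exactly those with side lengths $ab/d$ and $d$, where $h\le d\le a\wedge b$; (iii) $\mathcal R_{1i}$, $i=0,2$, are exactly those with side lengths $a$ and $b$, or $ab/d$ and $d$, where $0<d\le h$; (iv) $\mathcal R_{1i}$, $i=1,3$, are exactly those with side lengths $a$ and $b$, or $l$ and $h$.
   Context: Fix $a,b>0$. In the plane $\mathbb R^2$ with coordinates $(x,y)$ set $\mathcal D=\{x=a,\ 0<y<b\}$, $\mathcal A_0=\mathcal D\cup\{0<x<a\}$, $\mathcal B_0=\mathcal D\cup\{x>a\}$, $\mathcal A_1=\mathcal A_0\cap\{y>0\}$, $\mathcal B_1=\mathcal B_0\cap\{y>0\}$, $\mathcal B_2=\mathcal B_0\cap\{y<b\}$, $\mathcal B_3=\mathcal B_0\cap\{0<y<b\}$, and $\mathcal C_{ij}=\mathcal A_i\cup\mathcal B_j$ for $(i,j)\in\{0,1\}\times\{0,1,2,3\}$. An open rectangle $R$ (with sides in arbitrary directions) ''can move around the corner in $\mathcal C_{ij}$'' if there is a continuous path $\Phi_t$, $t\in[0,1]$, in the Euclidean group $E(2)$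 of rigid motions of the plane such that $\Phi_0(R)\subset\mathcal A_i$, $\Phi_1(R)\subset\mathcal B_j$ and $\Phi_t(R)\subset\mathcal C_{ij}$ for all $t\in[0,1]$. $\mathcal R_{ij}$ is the set of all such $R$ (so membership depends only on the side lengths). Notation: $a\wedge b=\min\{a,b\}$, $l=\sqrt{a^2+b^2}$, $h=ab/\sqrt{a^2+b^2}$. *)

(* Defs.v *)
From mathcomp Require Import all_boot all_order all_algebra.
From mathcomp Require Import all_classical all_reals all_analysis.
Set Implicit Arguments.
Unset Strict Implicit.
Unset Printing Implicit Defensive.
Import Order.TTheory GRing.Theory Num.Theory.
Import numFieldNormedType.Exports.
Local Open Scope classical_set_scope.
Local Open Scope ring_scope.

Notation plane R := 'cV[R]_2.

Definition xcoord (R : realType) (z : plane R) : R := z 0 0.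
Definition ycoord (R : realType) (z : plane R) : R := z 1 0.

(* The Euclidean group E(2) = O(2) |>< R^2, as a subset of the matrix-vector
   pairs, whose topology (entrywise convergence) it inherits; [(M, v)] acts on
   the plane by z |-> M z + v. *)
Definition E2 (R : realType) : set ('M[R]_2 * plane R) :=
  [set g | g.1 *m g.1^T = 1%:M].

Definition act (R : realType) (g : 'M[R]_2 * plane R) (z : plane R) : plane R :=
  g.1 *m z + g.2.

(* [rectangle p q S]: S is an open rectangle, in any position and direction,
   with side lengths p and q.  The order of p and q is irrelevant: E(2) contains
   the map exchanging the two coordinates. *)
Definition rectangle (R : realType) (p q : R) : set (set (plane R)) :=
  [set S | [/\ 0 < p, 0 < q &
    exists2 g, E2 g &
      S = act g @` [set z | 0 < xcoord z < p /\ 0 < ycoord z < q]]].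

Definition has_area (R : realType) (S : set (plane R)) (m : R) : Prop :=
  exists p q, rectangle p q S /\ m = p * q.

Section Corridors.
Variables (R : realType) (a b : R).

Definition door : set (plane R) :=
  [set z | xcoord z = a /\ 0 < ycoord z < b].

Definition A0 : set (plane R) := door `|` [set z | 0 < xcoord z < a].
Definition B0 : set (plane R) := door `|` [set z | a < xcoord z].

(* Only the values at i = 0, 1 and j = 0, 1, 2, 3 are meaningful. *)
Definition A_ (i : nat) : set (plane R) :=
  match i with
  | 0 => A0
  | _ => A0 `&` [set z | 0 < ycoord z]
  end.

Definition B_ (j : nat) : set (plane R) :=
  match j with
  | 0 => B0
  | 1 => B0 `&` [set z | 0 < ycoord z]
  | 2 => B0 `&` [set z | ycoord z < b]
  | _ => B0 `&` [set z | 0 < ycoord z < b]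
  end.

Definition C_ (i j : nat) : set (plane R) := A_ i `|` B_ j.

Definition can_move (i j : nat) (S : set (plane R)) : Prop :=
  exists Phi : R -> 'M[R]_2 * plane R,
    [/\ {within `[0, 1], continuous Phi},
        forall t : R, t \in `[0, 1] -> E2 (Phi t),
        act (Phi 0) @` S `<=` A_ i,
        act (Phi 1) @` S `<=` B_ j &
        forall t : R, t \in `[0, 1] -> act (Phi t) @` S `<=` C_ i j].

Definition R_ (i j : nat) : set (set (plane R)) :=
  [set S | (exists p q, rectangle p q S) /\ can_move i j S].

End Corridors.

Definition is_max_area (R : realType) (F : set (set (plane R))) (m : R) : Prop :=
  (exists2 S, F S & has_area S m) /\
  (forall S m', F S -> has_area S m' -> m' <= m).

Definition max_area_rectangles (R : realType) (F : set (set (plane R))) :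
    set (set (plane R)) :=
  [set S | F S /\ exists2 m, is_max_area F m & has_area S m].

(* Main.v *)
Require Import Defs.
From mathcomp Require Import all_boot all_order all_algebra.
From mathcomp Require Import all_classical all_reals all_analysis.
From mathcomp Require Import ring lra.
Set Implicit Arguments.
Unset Strict Implicit.
Unset Printing Implicit Defensive.
Import Order.TTheory GRing.Theory Num.Theory.
Import numFieldNormedType.Exports.
Local Open Scope classical_set_scope.
Local Open Scope ring_scope.

(** Let [M] and [N] be the two corners of the rectangle adjacent to its leftmost
    corner, at the ends of its sides [q] and [p], and let [c], [s] be the absolute
    cosine and sine of the angle of the side [p] with the horizontal.

    At the last time at which neither [M] nor [N] is to the right of [X = a], one
    of them, say [M], lies on this line, so [q s <= a] since the leftmost corner
    is in [X >= 0]; and the line cuts the two sides of length [q] in a chord of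
    length [p / s], which fits in the door, so [p <= b s].  Hence [p q <= a b],
    and equality determines [s = a / q = p / b].  The walls on the right bound the
    position of [M] just after this time, which yields [q <= l]; a floor on the
    left bounds the position just before the first time at which [M] or [N]
    reaches [X = a] with the rightmost corner already beyond it, which yields
    [q >= l], unless the sides are [a] and [b].

    Conversely, the rectangle is first turned with its leftmost corner on [X = 0]
    and then translated; the angle of sine [s] is the only critical one. *)

(** The path is merely continuous: near the critical time the orientation, and with it the corner
    that meets a wall, may change infinitely often, so no derivative or one-sided limit is
    available. The corner estimates are instead used at times accumulating at the critical time
    [tau]. In the tight case, [p = b * s tau], [a = q * s tau] and [0 <= x] reduce them to a
    condition on the sign of [(s t - s tau) * (q * c t - b)]. The position of [M] gives the sign of
    the first factor; that of the second, at [tau], is the sign of [q - l].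

    Absolute values reduce the four choices of a leftmost corner to one picture and keep [x], [c],
    [s] continuous, while the height and orientation of that corner jump. Exchanging [p] and [q]
    reverses the orientation, so each estimate is proved for one corner only. *)

(** * Closed rectangles in the corridor and the inequalities at the door *)

Section Position.
Variables (R : realType) (a b : R).
Hypotheses (a0 : 0 < a) (b0 : 0 < b).
Implicit Types (L D U : bool) (p q x y c s e X Y : R).

(* Membership of [(X, Y)] in the corridor; the flags [L], [D], [U] say whether
   the left part is bounded below, the right part below, the right part above. *)
Definition allowed L D U X Y : Prop :=
  [/\ 0 < X, X = a -> 0 < Y < b, X < a -> L -> 0 < Y,
      a < X -> D -> 0 < Y & a < X -> U -> Y < b].

(* The rectangle has its leftmost corner at [(x, y)] and the sides [p] and [q]
   in the directions [(c, - e s)] and [(s, e c)], where [e] is [1] or [-1]. *)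
Definition box_allowed L D U p q x y c s e : Prop :=
  forall B A, 0 < B < p -> 0 < A < q ->
  allowed L D U (x + B * c + A * s) (y + e * (A * c - B * s)).

(** Renaming the sides reverses the orientation, hence [- e]; estimates for one side thus give those
    for the other. *)
Lemma box_allowedC L D U p q x y c s e :
  box_allowed L D U p q x y c s e -> box_allowed L D U q p x y s c (- e).
Proof.
move=> H B A hB hA; have := H _ _ hA hB.
rewrite (_ : x + A * c + B * s = x + B * s + A * c); last by ring.
by rewrite (_ : e * (B * c - A * s) = - e * (A * s - B * c)) //; ring.
Qed.

(** If [u < 0], the affine function would vanish at [- u / (v - u)], inside the unit interval. Every
    passage from the open rectangle to its boundary rests on this. *)
Lemma segment_ge0 (u v : R) :
  (forall t, 0 < t < 1 -> 0 < (1 - t) * u + t * v) -> 0 <= u.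
Proof.
move=> H; rewrite leNgt; apply/negP => u0.
have h2 : 0 < (1 - 2^-1) * u + 2^-1 * v by apply: H; lra.
have d0 : 0 < v - u by lra.
have r01 : 0 < - u / (v - u) < 1.
  apply/andP; split; first by apply: divr_gt0; lra.
  by rewrite ltr_pdivrMr //; lra.
have E : - u / (v - u) * (v - u) = - u by rewrite divfK ?gt_eqF.
by have := H _ r01; move: E; set r := _ / _ => E; lra.
Qed.

Lemma scale_in (t r : R) : 0 < t < 1 -> 0 < r -> 0 < t * r < r.
Proof. by move=> /andP[t0 t1] r0; rewrite mulr_gt0 // gtr_pMl. Qed.

Section Closure.
Variables (L D U : bool) (p q x y c s e : R).
Hypotheses (p0 : 0 < p) (q0 : 0 < q) (c0 : 0 <= c) (s0 : 0 <= s).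
Hypothesis cs1 : c ^+ 2 + s ^+ 2 = 1.
Hypothesis box : box_allowed L D U p q x y c s e.

Let X B A := x + B * c + A * s.
Let Y B A := y + e * (A * c - B * s).

Lemma width_gt0 : 0 < p * c + q * s.
Proof.
have [cE|cn] := eqVneq c 0.
  have s1 : 0 < s.
    rewrite lt_def s0 andbT; apply/eqP => sE.
    by move: cs1; rewrite cE sE; lra.
  by have := mulr_gt0 q0 s1; rewrite cE; lra.
have c1 : 0 < c by rewrite lt_def c0 cn.
by have := mulr_gt0 p0 c1; have := mulr_ge0 (ltW q0) s0; lra.
Qed.

Lemma left_ge0 : 0 <= x.
Proof.
apply: (@segment_ge0 _ (x + p * c + q * s)) => t ht.
have hB : 0 < t * p < p by exact: scale_in.
have hA : 0 < t * q < q by exact: scale_in.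
have [+ _ _ _ _] := box hB hA.
by congr (0 < _); ring.
Qed.

Let mix t B B0 : R := (1 - t) * B + t * B0.

Let mix_in t B B0 r : 0 < t < 1 -> 0 <= B <= r -> 0 < B0 < r ->
  0 < mix t B B0 < r.
Proof.
move=> ht hB hB0; have [t0 t1] := andP ht; have t1' : 0 <= 1 - t by lra.
have h1 : 0 <= (1 - t) * B by apply: mulr_ge0 => //; lra.
have h2 : 0 <= (1 - t) * (r - B) by apply: mulr_ge0 => //; lra.
have h3 : 0 < t * B0 by apply: mulr_gt0 => //; lra.
have h4 : 0 < t * (r - B0) by apply: mulr_gt0 => //; lra.
by rewrite /mix; lra.
Qed.

Let mixX t B B0 A A0 : X (mix t B B0) (mix t A A0) = mix t (X B A) (X B0 A0).
Proof. by rewrite /X /mix; ring. Qed.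

Let mixY t B B0 A A0 : Y (mix t B B0) (mix t A A0) = mix t (Y B A) (Y B0 A0).
Proof. by rewrite /Y /mix; ring. Qed.

Let base r : 0 < r < 1 ->
  [/\ 0 < r * p < p, 0 < r * q < q & X (r * p) (r * q) = x + r * (p * c + q * s)].
Proof. by move=> hr; split; [exact: scale_in|exact: scale_in|rewrite /X; ring]. Qed.

Let ratio : x < a < x + p * c + q * s ->
  exists2 r, 0 < r < 1 & x + r * (p * c + q * s) = a.
Proof.
move=> h; have w0 := width_gt0; exists ((a - x) / (p * c + q * s)).
  by rewrite divr_gt0 ?ltr_pdivrMr //; lra.
by rewrite divfK ?gt_eqF //; lra.
Qed.

(** [P] is a convex condition on abscissas, [Q] an affine margin to a wall. Between a point of the
    closed rectangle and the interior diagonal point of parameter [r], the segment stays in the open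
    rectangle and in [P]. *)
Let closure (P : R -> Prop) (Q : R -> R) r B A :
    (forall t u v, 0 < t < 1 -> P u -> P v -> P (mix t u v)) ->
    (forall t u v, Q (mix t u v) = mix t (Q u) (Q v)) ->
    0 <= B <= p -> 0 <= A <= q -> P (X B A) ->
    0 < r < 1 -> P (x + r * (p * c + q * s)) ->
    (forall B0 A0, 0 < B0 < p -> 0 < A0 < q -> P (X B0 A0) -> 0 < Q (Y B0 A0)) ->
  0 <= Q (Y B A).
Proof.
move=> PP QQ hB hA PX hr Pr PQ.
have [hp hq E] := base hr.
apply: (@segment_ge0 _ (Q (Y (r * p) (r * q)))) => t ht.
rewrite -[(1 - t) * _ + _]/(mix _ _ _) -QQ -mixY.
by apply: PQ; [exact: mix_in|exact: mix_in|rewrite mixX; apply: PP; rewrite ?E].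
Qed.

Let mix_lt t u v r : 0 < t < 1 -> u < r -> v < r -> mix t u v < r.
Proof.
move=> /andP[t0 t1] ur vr.
have h1 : 0 < (1 - t) * (r - u) by apply: mulr_gt0 => //; lra.
have h2 : 0 < t * (r - v) by apply: mulr_gt0 => //; lra.
by rewrite /mix; lra.
Qed.

Let mix_gt t u v r : 0 < t < 1 -> r < u -> r < v -> r < mix t u v.
Proof.
move=> /andP[t0 t1] ur vr.
have h1 : 0 < (1 - t) * (u - r) by apply: mulr_gt0 => //; lra.
have h2 : 0 < t * (v - r) by apply: mulr_gt0 => //; lra.
by rewrite /mix; lra.
Qed.

Lemma closure_door B A : x < a < x + p * c + q * s ->
  0 <= B <= p -> 0 <= A <= q -> x + B * c + A * s = a ->
  0 <= y + e * (A * c - B * s) <= b.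
Proof.
move=> ha hB hA hX; have [r hr Er] := ratio ha.
have PP t u v : 0 < t < 1 -> u = a -> v = a -> mix t u v = a.
  by rewrite /mix => _ -> ->; ring.
apply/andP; split.
  apply: (@closure (eq^~ a) id r) => // B0 A0 hB0 hA0 E.
  by have [_ /(_ E)/andP[]] := box hB0 hA0.
rewrite -subr_ge0; apply: (@closure (eq^~ a) (fun Y => b - Y) r) => //.
  by move=> t u v; rewrite /mix; ring.
move=> B0 A0 hB0 hA0 E; have [_ /(_ E)/andP[]] := box hB0 hA0.
by rewrite subr_gt0.
Qed.

Lemma closure_left B A : L -> x < a -> 0 <= B <= p -> 0 <= A <= q ->
  x + B * c + A * s < a -> 0 <= y + e * (A * c - B * s).
Proof.
move=> l xa hB hA hX.
have w0 := width_gt0.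
(* The centre serves if the whole rectangle is on the left; otherwise the diagonal is followed
   halfway to its intersection with [X = a]. *)
have [r hr Er] : exists2 r, 0 < r < 1 & x + r * (p * c + q * s) < a.
  have [h|h] := ltP (x + p * c + q * s) a; first by exists 2^-1; lra.
  have d0 : 0 < (a - x) / (p * c + q * s) <= 1.
    by rewrite divr_gt0 ?ler_pdivrMr //; lra.
  have E : (a - x) / (p * c + q * s) * (p * c + q * s) = a - x.
    by rewrite divfK ?gt_eqF.
  exists ((a - x) / (p * c + q * s) / 2); first by lra.
  by move: E; set k := _ / (_ + _) => E; lra.
apply: (@closure (fun u => u < a) id r) => //.
  by move=> t u v ht ua va; exact: mix_lt.
by move=> B0 A0 hB0 hA0 E; have [_ _ /(_ E l)] := box hB0 hA0.
Qed.

Let base_right : a < x + p * c + q * s ->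
  exists2 r, 0 < r < 1 & a < x + r * (p * c + q * s).
Proof.
move=> ax; have w0 := width_gt0.
have [h|h] := ltP a x; first by exists 2^-1; lra.
have d0 : 0 < (x + p * c + q * s - a) / (p * c + q * s) <= 1.
  by rewrite divr_gt0 ?ler_pdivrMr //; lra.
have E : (x + p * c + q * s - a) / (p * c + q * s) * (p * c + q * s)
     = x + p * c + q * s - a.
  by rewrite divfK ?gt_eqF.
exists (1 - (x + p * c + q * s - a) / (p * c + q * s) / 2); first by lra.
by move: E; set k := _ / (_ + _) => E; lra.
Qed.

Lemma closure_right_below B A : D -> a < x + p * c + q * s ->
  0 <= B <= p -> 0 <= A <= q ->
  a < x + B * c + A * s -> 0 <= y + e * (A * c - B * s).
Proof.
move=> d ax hB hA hX; have [r hr Er] := base_right ax.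
apply: (@closure (fun u => a < u) id r) => //.
  by move=> t u v ht ua va; exact: mix_gt.
by move=> B0 A0 hB0 hA0 E; have [_ _ _ /(_ E d)] := box hB0 hA0.
Qed.

Lemma closure_right_above B A : U -> a < x + p * c + q * s ->
  0 <= B <= p -> 0 <= A <= q ->
  a < x + B * c + A * s -> y + e * (A * c - B * s) <= b.
Proof.
move=> u ax hB hA hX; have [r hr Er] := base_right ax.
rewrite -subr_ge0; apply: (@closure (fun u => a < u) (fun Y => b - Y) r) => //.
- by move=> t u' v ht ua va; exact: mix_gt.
- by move=> t u' v; rewrite /mix; ring.
move=> B0 A0 hB0 hA0 E; have [_ _ _ _ /(_ E u)] := box hB0 hA0.
by rewrite subr_gt0.
Qed.

Hypothesis e1 : e = 1 \/ e = -1.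

Let sides r : r * c ^+ 2 + r * s ^+ 2 = r.
Proof. by rewrite -mulrDr cs1 mulr1. Qed.

Let frac (r u v : R) : 0 < v -> 0 <= u <= r * v ->
  exists2 A, 0 <= A <= r & A * v = u.
Proof.
move=> v0 hu; exists (u / v); last by rewrite divfK ?gt_eqF.
by rewrite divr_ge0 ?ler_pdivrMr //; lra.
Qed.

(** The chord ends at the parameters [A1] and [A2] of the two sides [q]. Both ends are in the closed
    door, so [(A1 - A2) * c + p * s <= b] for either sign of [e]; multiplying by [s] avoids the
    quotient [p / s]. *)
Lemma chord_le : x + p * c <= a -> a <= x + q * s -> x < a ->
  a < x + p * c + q * s -> p <= b * s.
Proof.
move=> Na aM xa ax.
have s1 : 0 < s by rewrite -(pmulr_rgt0 _ q0); lra.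
have [A1 hA1 E1] : exists2 A, 0 <= A <= q & A * s = a - x by apply: frac => //; lra.
have [A2 hA2 E2] : exists2 A, 0 <= A <= q & A * s = a - x - p * c.
  by apply: frac => //; lra.
have h : x < a < x + p * c + q * s by lra.
have B0 : 0 <= (0 : R) <= p by rewrite lexx ltW.
have Bp : 0 <= p <= p by rewrite lexx ltW.
have H1 := closure_door h B0 hA1 ltac:(lra).
have H2 := closure_door h Bp hA2 ltac:(lra).
have K : (A1 - A2) * c + p * s <= b by case: e1 H1 H2 => ->; lra.
have : ((A1 - A2) * c + p * s) * s <= b * s by rewrite ler_pM2r.
by move: (congr1 ( *%R^~ c) E1) (congr1 ( *%R^~ c) E2) (sides p) => /=; lra.
Qed.

Let corner_le A2 : 0 < s -> A2 * s = a - x - p * c ->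
  q * c - A2 * c + p * s <= b -> p + (x + q * s - a) * c <= b * s.
Proof.
move=> s1 E2 K.
have : (q * c - A2 * c + p * s) * s <= b * s by rewrite ler_pM2r.
by move: (congr1 ( *%R^~ c) E2) (sides p) => /=; lra.
Qed.

(** The corner beyond the line is between the right walls, and the chord end on the opposite side is
    in the door; their heights differ by at most [b] for either sign of [e]. *)
Lemma corner_right : D -> U -> x + p * c <= a -> a < x + q * s -> x < a ->
  p + (x + q * s - a) * c <= b * s.
Proof.
move=> d u Na aM xa.
have s1 : 0 < s by rewrite -(pmulr_rgt0 _ q0); lra.
have pc0 : 0 <= p * c by exact: mulr_ge0 (ltW p0) c0.
have [A2 hA2 E2] : exists2 A, 0 <= A <= q & A * s = a - x - p * c.
  by apply: frac => //; lra.
have ax : a < x + p * c + q * s by lra.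
have h : x < a < x + p * c + q * s by lra.
have B0 : 0 <= (0 : R) <= p by rewrite lexx ltW.
have Bp : 0 <= p <= p by rewrite lexx ltW.
have Aq : 0 <= q <= q by rewrite lexx ltW.
have H2 := closure_door h Bp hA2 ltac:(lra).
have H3 := closure_right_below d ax B0 Aq ltac:(lra).
have H4 := closure_right_above u ax B0 Aq ltac:(lra).
by apply: (corner_le s1 E2); case: e1 H2 H3 H4 => ->; lra.
Qed.

(** The lowest corner is the right one if [e = -1] and the left one if [e = 1]. In both cases a
    floor bounds it, while the top of the door bounds the upper end of the chord. *)
Lemma corner_below : L -> D -> x + p * c < a -> a < x + q * s ->
  p + (x + q * s - a) * c <= b * s \/ p + (a - x - p * c) * c <= b * s.
Proof.
move=> l d Na aM.
have pc0 : 0 <= p * c by exact: mulr_ge0 (ltW p0) c0.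
have xa : x < a by lra.
have s1 : 0 < s by rewrite -(pmulr_rgt0 _ q0); lra.
have [A1 hA1 E1] : exists2 A, 0 <= A <= q & A * s = a - x by apply: frac => //; lra.
have [A2 hA2 E2] : exists2 A, 0 <= A <= q & A * s = a - x - p * c.
  by apply: frac => //; lra.
have ax : a < x + p * c + q * s by lra.
have h : x < a < x + p * c + q * s by lra.
have B0 : 0 <= (0 : R) <= p by rewrite lexx ltW.
have Bp : 0 <= p <= p by rewrite lexx ltW.
have A0 : 0 <= (0 : R) <= q by rewrite lexx ltW.
have Aq : 0 <= q <= q by rewrite lexx ltW.
have H1 := closure_door h B0 hA1 ltac:(lra).
have H2 := closure_door h Bp hA2 ltac:(lra).
have H3 := closure_right_below d ax B0 Aq ltac:(lra).
have H4 := closure_left l xa Bp A0 ltac:(lra).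
case: e1 => E; [right|left].
  have K : A1 * c + p * s <= b by rewrite E in H1 H4; lra.
  have : (A1 * c + p * s) * s <= b * s by rewrite ler_pM2r.
  by move: (congr1 ( *%R^~ c) E1) (sides p) => /=; lra.
by apply: (corner_le s1 E2); rewrite E in H2 H3; lra.
Qed.

(** Now the chord cuts the two sides at the rightmost corner. The sign of [e] tells which of the two
    left corners is lowest, hence which alternative holds. *)
Lemma corner_left : L -> x + p * c < a -> x + q * s < a ->
    a < x + p * c + q * s ->
  p + (x + q * s - a) * c <= b * s \/ q + (x + p * c - a) * s <= b * c.
Proof.
move=> l Na Ma ax.
have pc0 : 0 <= p * c by exact: mulr_ge0 (ltW p0) c0.
have s1 : 0 < s by rewrite -(pmulr_rgt0 _ q0); lra.
have c1 : 0 < c by rewrite -(pmulr_rgt0 _ p0); lra.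
have xa : x < a by lra.
have h : x < a < x + p * c + q * s by lra.
have B0 : 0 <= (0 : R) <= p by rewrite lexx ltW.
have Bp : 0 <= p <= p by rewrite lexx ltW.
have A0 : 0 <= (0 : R) <= q by rewrite lexx ltW.
have Aq : 0 <= q <= q by rewrite lexx ltW.
case: e1 => E; [right|left].
  have [B2 hB2 E2] : exists2 A, 0 <= A <= p & A * c = a - x - q * s.
    by apply: frac => //; lra.
  have H2 := closure_door h hB2 Aq ltac:(lra).
  have H4 := closure_left l xa Bp A0 ltac:(lra).
  have K : q * c - B2 * s + p * s <= b by rewrite E in H2 H4; lra.
  have : (q * c - B2 * s + p * s) * c <= b * c by rewrite ler_pM2r.
  by move: (congr1 ( *%R^~ s) E2) (sides q) => /=; lra.
have [A2 hA2 E2] : exists2 A, 0 <= A <= q & A * s = a - x - p * c.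
  by apply: frac => //; lra.
have H2 := closure_door h Bp hA2 ltac:(lra).
have H4 := closure_left l xa B0 Aq ltac:(lra).
by apply: (corner_le s1 E2); rewrite E in H2 H4; lra.
Qed.

End Closure.
End Position.

(** * Continuous functions on the unit interval: extreme zeros and accumulating times *)

Section UnitInterval.
Variable R : realType.
Implicit Types (F G : R -> R) (t u tau : R) (P Q : R -> Prop).

Local Notation cont F := {within `[(0 : R), 1]%classic, continuous F}.

Lemma cont_cst (k : R) : cont (fun=> k).
Proof. by move=> t; apply: cvg_cst. Qed.
Arguments cont_cst : clear implicits.

Lemma contD F G : cont F -> cont G -> cont (fun t => F t + G t).
Proof. by move=> cF cG t; apply: cvgD; [exact: cF|exact: cG]. Qed.

Lemma contN F : cont F -> cont (fun t => - F t).
Proof. by move=> cF t; apply: cvgN; exact: cF. Qed.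

Lemma contB F G : cont F -> cont G -> cont (fun t => F t - G t).
Proof. by move=> cF cG; apply: contD => //; exact: contN. Qed.

Lemma contM F G : cont F -> cont G -> cont (fun t => F t * G t).
Proof. by move=> cF cG t; apply: cvgM; [exact: cF|exact: cG]. Qed.

Lemma cont_norm F : cont F -> cont (fun t => `|F t|).
Proof. by move=> cF t; apply: cvg_norm; exact: cF. Qed.

Lemma cont_max F G : cont F -> cont G -> cont (fun t => Num.max (F t) (G t)).
Proof. by move=> cF cG t; apply: continuous_max; [exact: cF|exact: cG]. Qed.

Lemma cont_near F tau : cont F -> 0 <= tau <= 1 -> 0 < F tau ->
  exists2 r, 0 < r & forall t, 0 <= t <= 1 -> `|t - tau| < r -> 0 < F t.
Proof.
move=> /subspace_continuousP cF htau F0.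
have /cF : `[(0 : R), 1]%classic tau by rewrite /= in_itv.
move=> /cvgrPdist_lt/(_ _ F0).
rewrite near_withinE => /nbhs_ballP[r /= r0 H]; exists r => // t ht tr.
have := H t; rewrite /ball /= distrC in_itv /= => /(_ tr ht).
by rewrite ltr_norml /from_subspace; lra.
Qed.

(** Adherence of [tau] to [P] within the unit interval. Unlike an eventual property, it passes to
    one member of a disjunction however the alternatives alternate. *)
Definition often tau P : Prop :=
  forall r, 0 < r -> exists t, [/\ 0 <= t <= 1, `|t - tau| < r & P t].

Lemma often_imp tau P Q :
  (forall t, 0 <= t <= 1 -> P t -> Q t) -> often tau P -> often tau Q.
Proof.
by move=> PQ oP r r0; have [t [t1 tr Pt]] := oP _ r0; exists t; split; auto.
Qed.

Lemma often_or tau P Q :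
  often tau (fun t => P t \/ Q t) -> often tau P \/ often tau Q.
Proof.
move=> oPQ; have [|nP] := pselect (often tau P); [by left|right => r r0].
have [r' r'0 H] : exists2 r', 0 < r' &
    forall t, 0 <= t <= 1 -> `|t - tau| < r' -> ~ P t.
  apply: contrapT => K; apply: nP => r' r'0; apply: contrapT => K'.
  by apply: K; exists r' => // t t1 tr Pt; apply: K'; exists t.
have [|t [t1 tr [Pt|Qt]]] := oPQ (Num.min r r'); first by rewrite lt_min r0.
  by case: (H t t1 _ Pt); move: tr; rewrite lt_min => /andP[].
by exists t; split=> //; move: tr; rewrite lt_min => /andP[].
Qed.

Lemma often_gt0 tau P F : cont F -> 0 <= tau <= 1 -> 0 < F tau ->
  often tau P -> often tau (fun t => P t /\ 0 < F t).
Proof.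
move=> cF htau F0 oP r r0; have [r' r'0 H] := cont_near cF htau F0.
have [|t [t1 tr Pt]] := oP (Num.min r r'); first by rewrite lt_min r0.
by move: tr; rewrite lt_min => /andP[tr tr']; exists t; split; auto.
Qed.

Lemma often_ge0 tau F : cont F -> 0 <= tau <= 1 ->
  often tau (fun t => 0 <= F t) -> 0 <= F tau.
Proof.
move=> cF htau oF; rewrite leNgt; apply/negP => F0.
have [|r r0 H] := cont_near (contN cF) htau; first by lra.
by have [t [t1 tr Ft]] := oF _ r0; have := H t t1 tr; lra.
Qed.

Lemma last_time F : cont F -> F 0 <= 0 -> 0 < F 1 ->
  exists tau, [/\ 0 <= tau < 1, F tau = 0 & forall t, tau < t <= 1 -> 0 < F t].
Proof.
move=> cF F0 F1.
pose S := [set t : R | 0 <= t <= 1 /\ F t <= 0].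
have S0 : S 0 by rewrite /S /=; split=> //; lra.
have hS : has_sup S.
  by split; [exists 0|exists 1 => t [/andP[]]].
have tau0 : 0 <= sup S by apply: ub_le_sup => //; case: hS.
have tau1 : sup S <= 1.
  by apply: ge_sup; [exists 0|move=> t [/andP[]]].
have ht : 0 <= sup S <= 1 by lra.
have after t : sup S < t <= 1 -> 0 < F t.
  move=> htt; rewrite ltNge; apply/negP => Ft.
  have : t <= sup S by apply: ub_le_sup; [case: hS|split=> //; lra].
  lra.
have le0 : F (sup S) <= 0.
  rewrite -oppr_ge0; apply: (often_ge0 (contN cF) ht) => r r0.
  have [t [t1 Ft] tr] := sup_adherent r0 hS.
  exists t; split=> //; last by lra.
  have : t <= sup S by apply: ub_le_sup; [case: hS|split].
  by rewrite ltr_norml; lra.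
have lt1 : sup S < 1.
  by rewrite lt_neqAle tau1 andbT; apply/eqP => E; move: le0; rewrite E; lra.
exists (sup S); split=> //; first by lra.
apply/eqP; rewrite eq_le le0 /=; apply: often_ge0 => // r r0.
(* Half of this minimum keeps the sample time after [sup S], before 1 and within [r]. *)
have m0 : 0 < Num.min r (1 - sup S) by rewrite lt_min r0; lra.
have m1 : Num.min r (1 - sup S) <= r by rewrite ge_min lexx.
have m2 : Num.min r (1 - sup S) <= 1 - sup S by rewrite ge_min lexx orbT.
move: m0 m1 m2; set m := Num.min _ _ => m0 m1 m2.
exists (sup S + m / 2); split; [lra| |].
  by rewrite ltr_norml; lra.
by apply/ltW/after; lra.
Qed.

Lemma often_after tau P : 0 <= tau < 1 -> (forall t, tau < t <= 1 -> P t) ->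
  often tau P.
Proof.
move=> htau H r r0.
have m0 : 0 < Num.min r (1 - tau) by rewrite lt_min r0; lra.
have m1 : Num.min r (1 - tau) <= r by rewrite ge_min lexx.
have m2 : Num.min r (1 - tau) <= 1 - tau by rewrite ge_min lexx orbT.
move: m0 m1 m2; set m := Num.min _ _ => m0 m1 m2.
exists (tau + m / 2); split; [lra| |by apply: H; lra].
by rewrite ltr_norml; lra.
Qed.

Lemma first_time F t0 : cont F -> 0 <= t0 < 1 -> F t0 < 0 -> 0 < F 1 ->
  exists tau, [/\ t0 < tau < 1, F tau = 0 & forall t, t0 <= t < tau -> F t < 0].
Proof.
move=> cF ht0 F0 F1.
pose S := [set t : R | t0 <= t <= 1 /\ 0 <= F t].
have S1 : S 1 by rewrite /S /=; split; lra.
have hS : has_inf S.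
  by split; [exists 1|exists t0 => t [/andP[]]].
have tau1 : inf S <= 1 by apply: ge_inf => //; case: hS.
have tau0 : t0 <= inf S.
  by apply: lb_le_inf; [exists 1|move=> t [/andP[]]].
have ht : 0 <= inf S <= 1 by lra.
have before t : t0 <= t < inf S -> F t < 0.
  move=> htt; rewrite ltNge; apply/negP => Ft.
  have : inf S <= t by apply: ge_inf; [case: hS|split=> //; lra].
  lra.
have ge0 : 0 <= F (inf S).
  apply: (often_ge0 cF ht) => r r0.
  have [t [t1 Ft] tr] := inf_adherent r0 hS.
  exists t; split=> //; first by lra.
  have : inf S <= t by apply: ge_inf; [case: hS|split].
  by rewrite ltr_norml; lra.
have gt0 : t0 < inf S.
  by rewrite lt_neqAle tau0 andbT; apply/eqP => E; move: ge0; rewrite -E; lra.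
have E : F (inf S) = 0.
  apply/eqP; rewrite eq_le ge0 andbT -oppr_ge0.
  apply: (often_ge0 (contN cF) ht) => r r0.
  have m0 : 0 < Num.min r (inf S - t0) by rewrite lt_min r0; lra.
  have m1 : Num.min r (inf S - t0) <= r by rewrite ge_min lexx.
  have m2 : Num.min r (inf S - t0) <= inf S - t0 by rewrite ge_min lexx orbT.
  move: m0 m1 m2; set m := Num.min _ _ => m0 m1 m2.
  exists (inf S - m / 2); split; [lra| |].
    by rewrite ltr_norml; lra.
  by have := before (inf S - m / 2); rewrite oppr_ge0 => H; apply/ltW/H; lra.
exists (inf S); split=> //; rewrite gt0 lt_neqAle tau1 andbT /=.
by apply/eqP => E1; move: F1; rewrite -E1 E ltxx.
Qed.

Lemma often_before tau t0 P : 0 <= t0 < tau -> tau <= 1 ->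
  (forall t, t0 <= t < tau -> P t) -> often tau P.
Proof.
move=> htau tau1 H r r0.
have m0 : 0 < Num.min r (tau - t0) by rewrite lt_min r0; lra.
have m1 : Num.min r (tau - t0) <= r by rewrite ge_min lexx.
have m2 : Num.min r (tau - t0) <= tau - t0 by rewrite ge_min lexx orbT.
move: m0 m1 m2; set m := Num.min _ _ => m0 m1 m2.
exists (tau - m / 2); split; [lra| |by apply: H; lra].
by rewrite ltr_norml; lra.
Qed.

End UnitInterval.
Arguments cont_cst {R} k.

(** * Necessary conditions from the last crossing of the door *)

Section Necessity.
Variables (R : realType) (a b : R).
Hypotheses (a0 : 0 < a) (b0 : 0 < b).
Implicit Types (L D U : bool) (p q t tau : R) (x c s : R -> R).

Local Notation cont F := {within `[(0 : R), 1]%classic, continuous F}.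

(** [y] and [e] are chosen separately at each time, since they jump when another corner becomes
    leftmost. *)
Definition motion L D U p q x c s : Prop :=
  [/\ [/\ cont x, cont c & cont s],
      forall t, 0 <= t <= 1 -> [/\ 0 <= c t, 0 <= s t & c t ^+ 2 + s t ^+ 2 = 1],
      forall t, 0 <= t <= 1 -> exists y e, (e = 1 \/ e = -1) /\
        box_allowed a b L D U p q (x t) y (c t) (s t) e,
      x 0 + p * c 0 + q * s 0 <= a & a <= x 1].

Lemma motionC L D U p q x c s :
  motion L D U p q x c s -> motion L D U q p x s c.
Proof.
case=> -[cx cc cs] Hcs H H0 H1; split=> //; last by lra.
  by move=> t /Hcs[? ? ?]; split=> //; lra.
move=> t /H[y [e [e1 /box_allowedC K]]]; exists y, (- e); split=> //.
by case: e1 => ->; [right|left; rewrite opprK].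
Qed.

Section Motion.
Variables (L D U : bool) (p q : R) (x c s : R -> R).
Hypotheses (p0 : 0 < p) (q0 : 0 < q) (mot : motion L D U p q x c s).

Lemma motion_contl k : cont (fun t => k + (x t + p * c t)).
Proof.
have [[cx cc cs] _ _ _ _] := mot.
apply: contD; first exact: cont_cst.
by apply: contD => //; apply: contM => //; exact: cont_cst.
Qed.

Lemma motion_contr k : cont (fun t => k + (x t + q * s t)).
Proof.
have [[cx cc cs] _ _ _ _] := mot.
apply: contD; first exact: cont_cst.
by apply: contD => //; apply: contM => //; exact: cont_cst.
Qed.

Lemma motion_ge0 t : 0 <= t <= 1 -> 0 <= x t.
Proof.
move=> ht; have [_ /(_ t ht)[c1 s1 cs1] /(_ t ht)[y [e [e1 H]]] _ _] := mot.
exact: (left_ge0 p0 q0 H).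
Qed.

Lemma motion_width_gt0 t : 0 <= t <= 1 -> 0 < p * c t + q * s t.
Proof.
by move=> ht; have [_ /(_ t ht)[c1 s1 cs1] _ _ _] := mot; exact: width_gt0.
Qed.

Lemma motion_chord t : 0 <= t <= 1 ->
  x t + p * c t <= a -> a <= x t + q * s t -> x t < a ->
  a < x t + p * c t + q * s t -> p <= b * s t.
Proof.
move=> ht; have [_ /(_ t ht)[c1 s1 cs1] /(_ t ht)[y [e [e1 H]]] _ _] := mot.
exact: (chord_le p0 q0 c1 s1 cs1 H e1).
Qed.

Lemma motion_chord_lt t : 0 <= t <= 1 ->
  x t + p * c t < a -> a <= x t + q * s t ->
  a < x t + p * c t + q * s t -> p <= b * s t.
Proof.
move=> ht Na aM ax; have [_ /(_ t ht)[c1 s1 cs1] _ _ _] := mot.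
have := mulr_ge0 (ltW p0) c1 => pc0.
by apply: motion_chord => //; lra.
Qed.

Lemma motion_right t : D -> U -> 0 <= t <= 1 ->
  x t + p * c t < a -> a < x t + q * s t ->
  p + (x t + q * s t - a) * c t <= b * s t.
Proof.
move=> d u ht Na aM.
have [_ /(_ t ht)[c1 s1 cs1] /(_ t ht)[y [e [e1 H]]] _ _] := mot.
have := mulr_ge0 (ltW p0) c1 => pc0.
by apply: (corner_right p0 q0 c1 s1 cs1 H e1) => //; lra.
Qed.

Lemma motion_below t : L -> D -> 0 <= t <= 1 ->
  x t + p * c t < a -> a < x t + q * s t ->
  p + (x t + q * s t - a) * c t <= b * s t \/
  p + (a - x t - p * c t) * c t <= b * s t.
Proof.
move=> l d ht Na aM.
have [_ /(_ t ht)[c1 s1 cs1] /(_ t ht)[y [e [e1 H]]] _ _] := mot.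
exact: (corner_below p0 q0 c1 s1 cs1 H e1).
Qed.

Lemma motion_left t : L -> 0 <= t <= 1 ->
  x t + p * c t < a -> x t + q * s t < a -> a < x t + p * c t + q * s t ->
  p + (x t + q * s t - a) * c t <= b * s t \/
  q + (x t + p * c t - a) * s t <= b * c t.
Proof.
move=> l ht Na Ma ax.
have [_ /(_ t ht)[c1 s1 cs1] /(_ t ht)[y [e [e1 H]]] _ _] := mot.
exact: (corner_left p0 q0 c1 s1 cs1 H e1).
Qed.

(** The initial width [p * c + q * s] is at least the smaller side times [c + s], and
    [c + s >= 1]. *)
Lemma motion_start_min : Num.min p q <= a.
Proof.
have h0 : 0 <= (0 : R) <= 1 by rewrite lexx ler01.
have [_ /(_ 0 h0)[c1 s1 cs1] _ H0 _] := mot.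
have x0 := motion_ge0 h0.
have m0 : 0 < Num.min p q by rewrite lt_min p0.
have mp : Num.min p q <= p by rewrite ge_min lexx.
have mq : Num.min p q <= q by rewrite ge_min lexx orbT.
have h1 : 0 <= (p - Num.min p q) * c 0 by apply: mulr_ge0; lra.
have h2 : 0 <= (q - Num.min p q) * s 0 by apply: mulr_ge0; lra.
have c1' : c 0 <= 1 by nra.
have s1' : s 0 <= 1 by nra.
have cs : 1 <= c 0 + s 0 by nra.
have : 0 <= Num.min p q * (c 0 + s 0 - 1) by apply: mulr_ge0; lra.
lra.
Qed.

End Motion.

(* A time at which the corner after the side [q] lies on [X = a], the opposite
   corner lying to its left; unless that corner is on [X = a] too, the first one
   is to the right of [X = a] arbitrarily close to this time. *)
Definition crossing p q x c s tau : Prop :=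
  [/\ 0 <= tau <= 1, x tau + q * s tau = a, x tau + p * c tau <= a &
      x tau + p * c tau < a -> often tau (fun t =>
        x t + p * c t < a /\ a < x t + q * s t)].

(** [last_time] is applied to the larger of the two abscissas. If the other corner is strictly to
    the left, it stays there nearby, so it is the first corner that is beyond the line. *)
Lemma last_crossing L D U p q x c s : 0 < p -> 0 < q -> motion L D U p q x c s ->
  exists tau, crossing p q x c s tau \/ crossing q p x s c tau.
Proof.
move=> p0 q0 mot; have [[cx cc cs] Hcs H H0 H1] := mot.
have h0 : 0 <= (0 : R) <= 1 by rewrite lexx ler01.
have h1 : 0 <= (1 : R) <= 1 by rewrite lexx ler01.
pose F t := Num.max (- a + (x t + p * c t)) (- a + (x t + q * s t)).
have cl k := motion_contl mot k.
have cr k := motion_contr mot k.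
have cF : cont F by apply: cont_max; [exact: cl|exact: cr].
have F0 : F 0 <= 0.
  have [c1 s1 _] := Hcs _ h0.
  have := mulr_ge0 (ltW p0) c1; have := mulr_ge0 (ltW q0) s1.
  by rewrite /F ge_max => ? ?; apply/andP; split; lra.
have F1 : 0 < F 1.
  have [c1 s1 _] := Hcs _ h1.
  have := mulr_ge0 (ltW p0) c1; have := mulr_ge0 (ltW q0) s1.
  have := motion_width_gt0 p0 q0 mot h1.
  rewrite /F lt_max => w0 ? ?.
  by have [?|?] := leP (p * c 1) (q * s 1); apply/orP; [right|left]; lra.
have [tau [htau Ftau after]] := last_time cF F0 F1.
have ht : 0 <= tau <= 1 by lra.
have oF := often_after htau after.
exists tau.
have [le|/ltW le] := leP (x tau + p * c tau) (x tau + q * s tau); [left|right].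
  have E : x tau + q * s tau = a.
    by move: Ftau; rewrite /F max_r; lra.
  split=> // [|Na]; first by lra.
  have := often_gt0 (contN (cl (- a))) ht _ oF; move=> /(_ ltac:(lra)).
  apply: often_imp => t ht' [Ft Nt]; split; first by lra.
  by move: Ft; rewrite /F lt_max => /orP[]; lra.
have E : x tau + p * c tau = a.
  by move: Ftau; rewrite /F max_l; lra.
split=> // [|Na]; first by lra.
have := often_gt0 (contN (cr (- a))) ht _ oF; move=> /(_ ltac:(lra)).
apply: often_imp => t ht' [Ft Nt]; split; first by lra.
by move: Ft; rewrite /F lt_max => /orP[]; lra.
Qed.

Section Touching.
Variables (L D U : bool) (p q : R) (x c s : R -> R) (tau : R).
Hypotheses (p0 : 0 < p) (q0 : 0 < q) (mot : motion L D U p q x c s).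
Hypotheses (htau : 0 <= tau <= 1) (EM : x tau + q * s tau = a).
Hypothesis Hp : p <= b * s tau.

Let cs_tau : [/\ 0 <= c tau, 0 <= s tau & c tau ^+ 2 + s tau ^+ 2 = 1].
Proof. by have [_ + _ _ _] := mot; exact. Qed.

Lemma touching_q : q * s tau <= a.
Proof. by have := motion_ge0 p0 q0 mot htau; have := EM; lra. Qed.

(** The defect [a * b - p * q] is [(b * s tau - p) * q + b * (a - q * s tau)], a sum of nonnegative
    terms; in the tight case both vanish. *)
Lemma touching_area : p * q <= a * b.
Proof.
have h1 : 0 <= (b * s tau - p) * q by rewrite mulr_ge0 ?subr_ge0 ?Hp // ltW.
have h2 : 0 <= b * (a - q * s tau) by rewrite mulr_ge0 ?subr_ge0 ?touching_q // ltW.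
lra.
Qed.

Lemma touching_pb : p <= b.
Proof.
have [c1 s1 cs1] := cs_tau.
have s1' : s tau <= 1 by nra.
have := Hp; have : 0 <= b * (1 - s tau) by rewrite mulr_ge0 ?(ltW b0) ?subr_ge0.
lra.
Qed.

Lemma touching_tight : p * q = a * b ->
  [/\ q * s tau = a, p = b * s tau, x tau = 0 & 0 < s tau].
Proof.
move=> E.
have h1 : 0 <= (b * s tau - p) * q by rewrite mulr_ge0 ?subr_ge0 ?Hp // ltW.
have h2 : 0 <= b * (a - q * s tau) by rewrite mulr_ge0 ?subr_ge0 ?touching_q // ltW.
have e1 : (b * s tau - p) * q = 0 by lra.
have e2 : b * (a - q * s tau) = 0 by lra.
have q1 : q * s tau = a.
  by move/eqP: e2; rewrite mulf_eq0 gt_eqF //= => /eqP; lra.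
have q2 : p = b * s tau.
  by move/eqP: e1; rewrite mulf_eq0 (gt_eqF q0) orbF => /eqP; lra.
split=> //; first by have := EM; lra.
by rewrite -(pmulr_rgt0 _ q0) q1.
Qed.

(* In the tight case [q = a / s], hence [b < q c] is [a^2 + b^2 < q^2]. *)
Lemma tight_sqr : q * s tau = a ->
  (q ^+ 2 <= a ^+ 2 + b ^+ 2) = (q * c tau <= b).
Proof.
move=> E; have [c1 s1 cs1] := cs_tau.
have E2 : q ^+ 2 = a ^+ 2 + (q * c tau) ^+ 2.
  by rewrite -E -[LHS]mulr1 -cs1; ring.
rewrite E2 lerD2l ler_pXn2r ?nnegrE ?(ltW b0) //.
exact: mulr_ge0 (ltW q0) c1.
Qed.

(** If [b < q * c tau], the same holds nearby. At one such time the hypothesis first gives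
    [s tau < s t], then [(s t - s tau) * (q * c t - b) <= 0], a contradiction. *)
Lemma touching_far : p * q = a * b ->
  often tau (fun t => [/\ x t + p * c t < a, a < x t + q * s t &
    p + (x t + q * s t - a) * c t <= b * s t]) ->
  q ^+ 2 <= a ^+ 2 + b ^+ 2.
Proof.
move=> /touching_tight[Eq Ep x0 s0] oft; rewrite tight_sqr // leNgt.
apply/negP => bqc; have [[cx cc cs] Hcs _ _ _] := mot.
have cG : cont (fun t => q * c t - b).
  by apply: contB; [apply: contM => //|]; exact: cont_cst.
have := often_gt0 cG htau _ oft; rewrite subr_gt0 => /(_ bqc).
move=> /(_ 1 ltr01)[t [ht _ [[Na aM K] qc]]].
have [c1 s1 cs1] := Hcs _ ht.
have xt := motion_ge0 p0 q0 mot ht.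
have c0 : 0 < c t by rewrite -(pmulr_rgt0 _ q0); apply: lt_trans b0 _; lra.
have h1 : 0 < (x t + q * s t - a) * c t by apply: mulr_gt0; lra.
have sS : 0 < s t - s tau by rewrite -(pmulr_rgt0 _ b0); lra.
have h2 : 0 <= x t * c t by apply: mulr_ge0; lra.
have h3 : 0 < (s t - s tau) * (q * c t - b) by apply: mulr_gt0; lra.
have Ea : a * c t = q * s tau * c t by rewrite Eq.
lra.
Qed.

(** With the corner left of the line, [s t < s tau], so the same inequality now gives
    [b <= q * c t], which passes to the limit. *)
Lemma touching_near : p * q = a * b ->
  often tau (fun t => x t + q * s t < a /\
    p + (x t + q * s t - a) * c t <= b * s t) ->
  a ^+ 2 + b ^+ 2 <= q ^+ 2.
Proof.
move=> /touching_tight[Eq Ep x0 s0] oft.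
have [c1 s1 cs1] := cs_tau; have [[cx cc cs] Hcs _ _ _] := mot.
have cG : cont (fun t => q * c t - b).
  by apply: contB; [apply: contM => //|]; exact: cont_cst.
have bqc : 0 <= q * c tau - b.
  apply: (often_ge0 cG htau); apply: often_imp oft => t ht [Ma K].
  have [c1' s1' _] := Hcs _ ht; have xt := motion_ge0 p0 q0 mot ht.
  have sS : 0 < s tau - s t by rewrite -(pmulr_rgt0 _ q0); lra.
  have h2 : 0 <= x t * c t by apply: mulr_ge0; lra.
  have Ea : a * c t = q * s tau * c t by rewrite Eq.
  by rewrite -(pmulr_rge0 _ sS); lra.
have E2 : q ^+ 2 = a ^+ 2 + (q * c tau) ^+ 2.
  by rewrite -Eq -[LHS]mulr1 -cs1; ring.
have b1 : 0 < b := b0.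
by rewrite E2 lerD2l ler_pXn2r ?nnegrE ?(ltW b0) //; lra.
Qed.

Lemma touching_both : p * q = a * b -> x tau + p * c tau = a -> q = b * c tau.
Proof.
move=> /touching_tight[Eq Ep x0 s0] E.
apply: (mulIf (x := s tau)); first by rewrite gt_eqF.
by rewrite Eq; move: E; rewrite x0 Ep; lra.
Qed.

Lemma touching_both_small : p * q = a * b -> x tau + p * c tau = a ->
  q ^+ 2 <= a ^+ 2 + b ^+ 2.
Proof.
move=> E Na; have Eq := touching_both E Na.
have [c1 s1 cs1] := cs_tau.
rewrite Eq exprMn; have a2 := sqr_ge0 a; have b2 := sqr_ge0 b.
have : 0 <= b ^+ 2 * s tau ^+ 2 by rewrite mulr_ge0 ?sqr_ge0.
have : b ^+ 2 * c tau ^+ 2 + b ^+ 2 * s tau ^+ 2 = b ^+ 2 by rewrite -mulrDr cs1 mulr1.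
lra.
Qed.

Lemma touching_small_p : p ^+ 2 <= a ^+ 2 + b ^+ 2.
Proof.
have := touching_pb; have := sqr_ge0 a => a2 pb.
have : p ^+ 2 <= b ^+ 2 by rewrite ler_pXn2r ?nnegrE ?(ltW p0) ?(ltW b0).
lra.
Qed.

End Touching.

Section Crossing.
Variables (L D U : bool) (p q : R) (x c s : R -> R) (tau : R).
Hypotheses (p0 : 0 < p) (q0 : 0 < q) (mot : motion L D U p q x c s).
Hypothesis cro : crossing p q x c s tau.

Let htau : 0 <= tau <= 1. Proof. by case: cro. Qed.
Let EM : x tau + q * s tau = a. Proof. by case: cro. Qed.
Let cs_tau : [/\ 0 <= c tau, 0 <= s tau & c tau ^+ 2 + s tau ^+ 2 = 1].
Proof. by have [_ + _ _ _] := mot; exact. Qed.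

(** At [tau] the whole rectangle may lie in [X <= a], with no chord to measure. Unless both corners
    are on the line, the bound is therefore a limit of chord bounds at nearby times. *)
Lemma crossing_p : p <= b * s tau.
Proof.
have [_ E le of_] := cro; have [c1 s1 cs1] := cs_tau.
have [[cx cc cs] _ _ _ _] := mot.
have w0 := motion_width_gt0 p0 q0 mot htau.
have [eqa|lt] := leP a (x tau + p * c tau).
  have EE : p * c tau = q * s tau by lra.
  apply: (motion_chord p0 q0 mot htau); lra.
have := of_ lt; move/(often_imp (Q := fun t => 0 <= b * s t - p)) => K.
rewrite -subr_ge0.
have cG : cont (fun t => b * s t - p).
  by apply: contB; [apply: contM => //|]; exact: cont_cst.
apply: (often_ge0 cG htau); apply: K => t ht [Na aM].
have [_ /(_ t ht)[c1' s1' _] _ _ _] := mot.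
have := mulr_ge0 (ltW p0) c1'.
by rewrite subr_ge0 => ?; apply: (motion_chord_lt p0 q0 mot ht); lra.
Qed.

Lemma crossing_band : D -> U -> p * q = a * b -> q ^+ 2 <= a ^+ 2 + b ^+ 2.
Proof.
move=> d u E; have [_ E' le oft] := cro.
have [ge|lt] := leP a (x tau + p * c tau).
  by apply: (touching_both_small p0 q0 mot htau EM crossing_p) => //; lra.
apply: (touching_far p0 q0 mot htau EM crossing_p) => //.
apply: often_imp (oft lt) => t ht [Na aM].
by split=> //; exact: (motion_right p0 q0 mot d u ht).
Qed.

Lemma crossing_below : L -> D -> p * q = a * b ->
  (p = b /\ q = a) \/ q ^+ 2 <= a ^+ 2 + b ^+ 2.
Proof.
move=> l d E; have [_ E' le oft] := cro.
have [ge|lt] := leP a (x tau + p * c tau).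
  by right; apply: (touching_both_small p0 q0 mot htau EM crossing_p) => //; lra.
have K : often tau (fun t =>
    [/\ x t + p * c t < a, a < x t + q * s t &
        p + (x t + q * s t - a) * c t <= b * s t] \/
    0 <= b * s t - p - (a - x t - p * c t) * c t).
  apply: often_imp (oft lt) => t ht [Na aM].
  have [K|K] := motion_below p0 q0 mot l d ht Na aM; first by left.
  by right; lra.
have [K1|K1] := often_or K.
  by right; exact: (touching_far p0 q0 mot htau EM crossing_p).
(* In the limit the second alternative reads [(a - p * c tau) * c tau <= 0], because [x tau = 0] and
   [p = b * s tau]. The first factor is positive, so the side [p] is vertical. *)
left; have [[cx cc cs] _ _ _ _] := mot; have [c1 s1 cs1] := cs_tau.
have cG : cont (fun t => b * s t - p - (a - x t - p * c t) * c t).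
  exact: (contB (contB (contM (cont_cst b) cs) (cont_cst p))
    (contM (contB (contB (cont_cst a) cx) (contM (cont_cst p) cc)) cc)).
have := often_ge0 cG htau K1.
have [Eq Ep x0 s0] := touching_tight p0 q0 mot htau EM crossing_p E.
rewrite -Ep subrr sub0r oppr_ge0 pmulr_rle0; last by lra.
move=> c_le; have c_0 : c tau = 0 by lra.
have s_1 : s tau = 1.
  move: cs1; rewrite c_0 expr0n add0r => /eqP; rewrite sqrf_eq1.
  by case/orP => /eqP; lra.
by move: Ep Eq; rewrite s_1 !mulr1.
Qed.

End Crossing.

End Necessity.
Arguments motion_contl {R a b L D U p q x c s} _ k.
Arguments motion_contr {R a b L D U p q x c s} _ k.

(** * The floor on the left and the first entry of a corner *)

Section Entering.
Variables (R : realType) (a b : R).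
Hypotheses (a0 : 0 < a) (b0 : 0 < b).
Implicit Types (L D U : bool) (p q t tau : R) (x c s : R -> R).

Local Notation cont F := {within `[(0 : R), 1]%classic, continuous F}.
Local Notation motion := (motion a b).

Let cont_slack k1 q x c s : cont x -> cont c -> cont s ->
  cont (fun t => b * s t - (k1 + (x t + q * s t - a) * c t)).
Proof.
move=> cx cc cs.
exact: (contB (contM (cont_cst b) cs) (contD (cont_cst k1)
  (contM (contB (contD cx (contM (cont_cst q) cs)) (cont_cst a)) cc))).
Qed.

Definition entering p q x c s tau : Prop :=
  [/\ 0 <= tau <= 1, x tau + q * s tau = a, x tau + p * c tau <= a,
      a < x tau + p * c tau + q * s tau &
      often tau (fun t => [/\ x t + p * c t < a, x t + q * s t < a &
        a < x t + p * c t + q * s t])].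

Lemma entering_far L D U p q x c s tau : 0 < p -> 0 < q ->
  motion L D U p q x c s -> L -> entering p q x c s tau -> p * q = a * b ->
  a ^+ 2 + b ^+ 2 <= q ^+ 2 \/ a ^+ 2 + b ^+ 2 <= p ^+ 2.
Proof.
move=> p0 q0 mot l [htau EM Na x4 oft] E.
have b1 : 0 < b := b0.
have [[cx cc cs] Hcs _ _ _] := mot; have [c1 s1 cs1] := Hcs _ htau.
have c0 : 0 < c tau by rewrite -(pmulr_rgt0 _ p0); lra.
have K : often tau (fun t =>
    (x t + q * s t < a /\ p + (x t + q * s t - a) * c t <= b * s t) \/
    (x t + p * c t < a /\ q + (x t + p * c t - a) * s t <= b * c t)).
  apply: often_imp oft => t ht [Nt Mt x4t].
  by have [H|H] := motion_left p0 q0 mot l ht Nt Mt x4t; [left|right].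
have cG : cont (fun t => b * s t - (p + (x t + q * s t - a) * c t)).
  exact: cont_slack.
have cG' : cont (fun t => b * c t - (q + (x t + p * c t - a) * s t)).
  exact: cont_slack.
have [K1|K1] := often_or K.
  left; apply: (touching_near a0 b0 p0 q0 mot htau EM _ E K1).
  have : 0 <= b * s tau - (p + (x tau + q * s tau - a) * c tau).
    by apply: (often_ge0 cG htau); apply: often_imp K1 => t ht [_]; lra.
  by rewrite EM; lra.
(* The second alternative concerns the other corner. Its limit forces [q = b * c tau], which puts
   that corner on [X = a] too, and [touching_near] applies with the sides exchanged. *)
have lim : q + (x tau + p * c tau - a) * s tau <= b * c tau.
  rewrite -subr_ge0; apply: (often_ge0 cG' htau); apply: often_imp K1 => t ht [_].
  by lra.
have lim2 : q * c tau + p * s tau <= b.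
  rewrite -(ler_pM2r c0).
  have : q * c tau ^+ 2 + q * s tau ^+ 2 = q by rewrite -mulrDr cs1 mulr1.
  have : (x tau + q * s tau) * s tau = a * s tau by rewrite EM.
  lra.
have Hp : p <= b * s tau.
  have h1 : 0 <= s tau * (b - (q * c tau + p * s tau)) by rewrite mulr_ge0 ?subr_ge0.
  have h2 : 0 <= c tau * (q * s tau - p * c tau) by rewrite mulr_ge0 //; lra.
  have : p * c tau ^+ 2 + p * s tau ^+ 2 = p by rewrite -mulrDr cs1 mulr1.
  lra.
have [Eq Ep x0 s0] := touching_tight a0 b0 p0 q0 mot htau EM Hp E.
have q_le : q <= b * c tau.
  have Es : p * s tau = b * s tau ^+ 2 by rewrite Ep; ring.
  have Ec : b * c tau ^+ 2 + b * s tau ^+ 2 = b by rewrite -mulrDr cs1 mulr1.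
  by rewrite -(ler_pM2r c0); lra.
have q_ge : b * c tau <= q.
  by rewrite -(ler_pM2r s0) Eq; move: Na; rewrite x0 Ep; lra.
have Eqb : q = b * c tau by lra.
have EN : x tau + p * c tau = a.
  by rewrite -Eq x0 Ep Eqb; ring.
right; apply: (touching_near a0 b0 q0 p0 (motionC mot) htau EN _ _ K1); first by lra.
by rewrite mulrC.
Qed.

(* The exceptional case: one side is vertical and lies on [X = a] at the last
   time [tau] at which the whole rectangle is in the left part. *)
Lemma aligned L D U p q x c s tau : 0 < p -> 0 < q ->
  motion L D U p q x c s -> 0 <= tau <= 1 ->
  x tau + p * c tau + q * s tau <= a -> p * q = a * b ->
  often tau (fun t => a <= x t + q * s t /\ a < x t + p * c t + q * s t) ->
  p = b /\ q = a.
Proof.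
move=> p0 q0 mot htau x4 E oft.
have [[cx cc cs] Hcs _ _ _] := mot; have [c1 s1 cs1] := Hcs _ htau.
have cG : cont (fun t => - a + (x t + q * s t)) := motion_contr mot (- a).
have aM : a <= x tau + q * s tau.
  have : 0 <= - a + (x tau + q * s tau).
    by apply: (often_ge0 cG htau); apply: often_imp oft => t ht [H _]; lra.
  lra.
have pc0 : 0 <= p * c tau by rewrite mulr_ge0 ?(ltW p0).
have c_0 : c tau = 0.
  have /eqP : p * c tau = 0 by lra.
  by rewrite mulf_eq0 gt_eqF //= => /eqP.
have s_1 : s tau = 1.
  move: cs1; rewrite c_0 expr0n add0r => /eqP; rewrite sqrf_eq1.
  by case/orP => /eqP; lra.
rewrite s_1 in aM x4; rewrite c_0 in x4.
have xtau := motion_ge0 p0 q0 mot htau.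
have cN := contN (motion_contl mot (- a)).
have Nlt : 0 < - (- a + (x tau + p * c tau)) by rewrite c_0; lra.
have oft' := often_gt0 cN htau Nlt oft.
have Hp : p <= b * s tau.
  have cH : cont (fun t => b * s t - p).
    exact: contB (contM (cont_cst b) cs) (cont_cst p).
  rewrite -subr_ge0; apply: (often_ge0 cH htau).
  apply: often_imp oft' => t ht [[Mt x4t] Nt]; rewrite subr_ge0.
  by apply: (motion_chord_lt p0 q0 mot ht) => //; lra.
have EM : x tau + q * s tau = a by rewrite s_1; lra.
have [Eq Ep _ _] := touching_tight a0 b0 p0 q0 mot htau EM Hp E.
by move: Eq Ep; rewrite s_1 !mulr1.
Qed.

Lemma first_entering L D U p q x c s : 0 < p -> 0 < q ->
    motion L D U p q x c s -> L -> p * q = a * b ->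
  [\/ p = b /\ q = a, p = a /\ q = b, a ^+ 2 + b ^+ 2 <= q ^+ 2 |
      a ^+ 2 + b ^+ 2 <= p ^+ 2].
Proof.
move=> p0 q0 mot l E; have [[cx cc cs] Hcs H H0 H1] := mot.
have Eqp : q * p = a * b by rewrite mulrC.
have h0 : 0 <= (0 : R) <= 1 by rewrite lexx ler01.
have h1 : 0 <= (1 : R) <= 1 by rewrite lexx ler01.
have cl k := motion_contl mot k.
have cr k := motion_contr mot k.
pose G t := - a + (x t + p * c t) + q * s t.
have cG : cont G.
  by apply: contD; [exact: cl|apply: contM => //; exact: cont_cst].
pose F t := Num.max (- a + (x t + p * c t)) (- a + (x t + q * s t)).
have cF : cont F by apply: cont_max; [exact: cl|exact: cr].
have F1 : 0 < F 1.
  have [c1 s1 _] := Hcs _ h1.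
  have := mulr_ge0 (ltW p0) c1; have := mulr_ge0 (ltW q0) s1.
  have := motion_width_gt0 p0 q0 mot h1.
  rewrite /F lt_max => w0 ? ?.
  by have [?|?] := leP (p * c 1) (q * s 1); apply/orP; [right|left]; lra.
have [||sig [hsig Gsig after]] := last_time cG.
- by rewrite /G; lra.
- by have := motion_width_gt0 p0 q0 mot h1; rewrite /G; lra.
have hs : 0 <= sig <= 1 by lra.
(* Either [M] or [N] reaches the line together with the rightmost corner, arbitrarily close to
   [sig], which is the aligned case, or the rightmost corner passes strictly before them. *)
have [oft|noft] := pselect (often sig (fun t => 0 <= F t /\ 0 < G t)).
  have : often sig (fun t =>
      (a <= x t + q * s t /\ a < x t + p * c t + q * s t) \/
      (a <= x t + p * c t /\ a < x t + q * s t + p * c t)).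
    apply: often_imp oft => t ht; rewrite /F /G le_max => -[/orP[h|h] g].
      by right; split; lra.
    by left; split; lra.
  case/often_or => K.
    by constructor 1; apply: (aligned p0 q0 mot hs _ E K); rewrite /G in Gsig; lra.
  have [-> ->] : q = b /\ p = a.
    apply: (aligned q0 p0 (motionC mot) hs _ Eqp K).
    by rewrite /G in Gsig; lra.
  by constructor 2.
have [r r0 Hr] : exists2 r, 0 < r &
    forall t, 0 <= t <= 1 -> `|t - sig| < r -> ~ (0 <= F t /\ 0 < G t).
  apply: contrapT => K; apply: noft => r r0; apply: contrapT => K'.
  by apply: K; exists r => // t t1 tr Pt; apply: K'; exists t.
have m0 : 0 < Num.min r (1 - sig) by rewrite lt_min r0; lra.
have m1 : Num.min r (1 - sig) <= r by rewrite ge_min lexx.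
have m2 : Num.min r (1 - sig) <= 1 - sig by rewrite ge_min lexx orbT.
move: m0 m1 m2; set m := Num.min _ _ => m0 m1 m2.
(* From this time on [G] stays positive, while [F] is still negative: the next zero of [F] is an
   entry with the rightmost corner already beyond the line. *)
have ht0 : 0 <= sig + m / 2 < 1 by lra.
have Ft0 : F (sig + m / 2) < 0.
  rewrite ltNge; apply/negP => Ft; apply: (Hr (sig + m / 2)).
  - by lra.
  - by rewrite ltr_norml; lra.
  by split=> //; apply: after; lra.
have [tau [htau Ftau before]] := first_time cF ht0 Ft0 F1.
have ht : 0 <= tau <= 1 by lra.
have oft : often tau (fun t => [/\ x t + p * c t < a, x t + q * s t < a &
        a < x t + p * c t + q * s t]).
  apply: (@often_before _ tau (sig + m / 2)); [lra|lra|] => t htt.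
  have := before t htt; have := after t; rewrite /F /G gt_max => g /andP[f1 f2].
  by split; [lra|lra|have := g ltac:(lra); lra].
have Gtau := after tau; rewrite /G in Gtau.
have {}Gtau : 0 < - a + (x tau + p * c tau) + q * s tau by apply: Gtau; lra.
have [le|/ltW le] := leP (x tau + p * c tau) (x tau + q * s tau).
  have EM : x tau + q * s tau = a by move: Ftau; rewrite /F max_r; lra.
  have [] := entering_far p0 q0 mot l (tau := tau) _ E; first by split=> //; lra.
    by constructor 3.
  by constructor 4.
have EM : x tau + p * c tau = a by move: Ftau; rewrite /F max_l; lra.
have [] := entering_far q0 p0 (motionC mot) l (tau := tau) _ Eqp.
- split=> //; [lra|lra|].
  by apply: often_imp oft => t _ [? ? ?]; split=> //; lra.
- by constructor 4.
by constructor 3.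
Qed.

End Entering.

(** * Rigid motions of the plane in coordinates *)

Section Plane.
Variable R : realType.
Implicit Types (g h : 'M[R]_2 * plane R) (z : plane R).

Lemma mulmx2E n (M : 'M[R]_2) (N : 'M[R]_(2, n)) i j :
  (M *m N) i j = M i 0 * N 0 j + M i 1 * N 1 j.
Proof.
rewrite mxE !big_ord_recl big_ord0 addr0; congr (_ * _ + M _ _ * N _ _).
all: exact: val_inj.
Qed.

Lemma ord2P (i : 'I_2) : i = 0 \/ i = 1.
Proof. by case: i => -[|[|//]] ?; [left|right]; exact: val_inj. Qed.

Definition pt (X Y : R) : plane R := \col_i (if i == 0 then X else Y).

Lemma xcoord_pt X Y : xcoord (pt X Y) = X.
Proof. by rewrite /xcoord mxE. Qed.

Lemma ycoord_pt X Y : ycoord (pt X Y) = Y.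
Proof. by rewrite /ycoord mxE. Qed.

Lemma xcoord_act g z :
  xcoord (act g z) = g.1 0 0 * xcoord z + g.1 0 1 * ycoord z + g.2 0 0.
Proof. by rewrite /xcoord /act mxE mulmx2E. Qed.

Lemma ycoord_act g z :
  ycoord (act g z) = g.1 1 0 * xcoord z + g.1 1 1 * ycoord z + g.2 1 0.
Proof. by rewrite /ycoord /act mxE mulmx2E. Qed.

Lemma plane_eq z z' : xcoord z = xcoord z' -> ycoord z = ycoord z' -> z = z'.
Proof.
move=> hx hy; apply/matrixP => i j; rewrite ord1.
by have [->|->] := ord2P i; [exact: hx|exact: hy].
Qed.

Definition ecomp g h : 'M[R]_2 * plane R := (g.1 *m h.1, g.1 *m h.2 + g.2).

Lemma act_ecomp g h z : act (ecomp g h) z = act g (act h z).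
Proof. by rewrite /act /= mulmxDr mulmxA addrA. Qed.

Lemma E2_ecomp g h : E2 g -> E2 h -> E2 (ecomp g h).
Proof.
by rewrite /E2 /= => hg hh; rewrite trmx_mul mulmxA -(mulmxA g.1) hh mulmx1.
Qed.

(** [e] is the determinant; its square is 1 by the Lagrange identity for the two rows. *)
Lemma E2P g : E2 g -> exists2 e, e = 1 \/ e = -1 &
  [/\ g.1 0 0 ^+ 2 + g.1 0 1 ^+ 2 = 1, g.1 1 0 = - (e * g.1 0 1) &
      g.1 1 1 = e * g.1 0 0].
Proof.
move=> hg.
have H i j : g.1 i 0 * g.1 j 0 + g.1 i 1 * g.1 j 1 = (i == j)%:R.
  by have := congr1 (fun M : 'M[R]_2 => M i j) hg; rewrite mulmx2E !mxE.
have /= := H 0 0; have /= := H 0 1; have /= := H 1 1.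
move: (g.1 0 0) (g.1 0 1) (g.1 1 0) (g.1 1 1) => u w u' w' h11 h01 h00.
exists (u * w' - w * u').
  have : (u * w' - w * u' - 1) * (u * w' - w * u' + 1) = 0.
    rewrite (_ : _ * _ = (u * u + w * w) * (u' * u' + w' * w') -
      (u * u' + w * w') ^+ 2 - 1); last by ring.
    by rewrite h11 h01 h00; ring.
  by move/eqP; rewrite mulf_eq0 => /orP[] /eqP ?; [left|right]; lra.
split; first by lra.
  rewrite (_ : - ((u * w' - w * u') * w) =
    u' * (u * u + w * w) - u * (u * u' + w * w')); last by ring.
  by rewrite h01 h00; ring.
rewrite (_ : (u * w' - w * u') * u =
  w' * (u * u + w * w) - w * (u * u' + w * w')); last by ring.
by rewrite h01 h00; ring.
Qed.

Definition std (p q : R) : set (plane R) :=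
  [set z | 0 < xcoord z < p /\ 0 < ycoord z < q].

(** The abscissa of the leftmost corner of the image of [std p q]: a side contributes only if it
    points to the left. The absolute values make this continuous in [g]. *)
Definition leftmost (p q : R) g : R :=
  g.2 0 0 + (p * (g.1 0 0 - `|g.1 0 0|) + q * (g.1 0 1 - `|g.1 0 1|)) / 2.

(** A side pointing to the left is traversed backwards, from [p] or [q] down; each such reversal
    changes the sign of the orientation. *)
Lemma corner_form (p q : R) g : E2 g ->
  exists y e, (e = 1 \/ e = -1) /\ forall B A, 0 < B < p -> 0 < A < q ->
  exists2 z, std p q z &
    xcoord (act g z) = leftmost p q g + B * `|g.1 0 0| + A * `|g.1 0 1| /\
    ycoord (act g z) = y + e * (A * `|g.1 0 0| - B * `|g.1 0 1|).
Proof.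
move=> hg; have [e0 he0 [_ h10 h11]] := E2P hg.
set u := g.1 0 0; set w := g.1 0 1.
exists (g.2 1 0 + e0 * ((if w < 0 then q * u else 0) - (if u < 0 then p * w else 0))).
exists (e0 * (if u < 0 then -1 else 1) * (if w < 0 then -1 else 1)).
split.
  by case: he0 => ->; case: ifP => _; case: ifP => _;
    [left|right|right|left|right|left|left|right]; lra.
move=> B A hB hA.
exists (pt (if u < 0 then p - B else B) (if w < 0 then q - A else A)).
  by rewrite /std /= xcoord_pt ycoord_pt; split; case: ifP => _; lra.
rewrite xcoord_act ycoord_act xcoord_pt ycoord_pt /leftmost h10 h11 -/u -/w.
have [u0|u0] := ltP u 0; have [w0|w0] := ltP w 0;
  rewrite ?(ltr0_norm u0) ?(ger0_norm u0) ?(ltr0_norm w0) ?(ger0_norm w0);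
  split; lra.
Qed.

End Plane.

(** * From paths in the Euclidean group to motions of the leftmost corner *)

Section Coordinates.
Variables (R : realType) (a b : R).
Hypotheses (a0 : 0 < a) (b0 : 0 < b).
Local Notation cont F := {within `[(0 : R), 1]%classic, continuous F}.

(** The binary digits of [j] are the flags: the low one for the floor on the right, the high one for
    the ceiling. *)
Lemma C_allowed i j z : (i <= 1)%N -> (j <= 3)%N ->
  C_ a b i j z <-> allowed a b (0 < i)%N (odd j) (1 < j)%N (xcoord z) (ycoord z).
Proof.
have a1 := a0.
move=> hi hj; rewrite /C_ /=; set X := xcoord z; set Y := ycoord z; split.
  have A0E : A0 a b z -> allowed a b (0 < i)%N (odd j) (1 < j)%N X Y \/ 0 < X < a.
    case=> [[E hY]|hX]; [left|by right].
    by rewrite [X]E; split; rewrite ?ltxx.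
  have B0E : B0 a b z -> allowed a b (0 < i)%N (odd j) (1 < j)%N X Y \/ a < X.
    case=> [[E hY]|hX]; [left|by right].
    by rewrite [X]E; split; rewrite ?ltxx.
  case.
    move=> H; have /A0E : A0 a b z by case: i hi H {A0E B0E} => [//|i] _ [].
    case=> // hX; split; try lra.
    by case: i hi H {A0E B0E} => [//|i] _ [].
  move=> H; have /B0E : B0 a b z.
    by case: j hj H {A0E B0E} => [//|[|[|j]]] _ [].
  case=> // hX; split; try lra.
    by case: j hj H {A0E B0E} => [//|[|[|[|j]]]] // _ [] //= _ /andP[].
  by case: j hj H {A0E B0E} => [//|[|[|[|j]]]] // _ [] //= _ /andP[].
case=> X0 Xa Xl Xd Xu.
have [lt|gt|E] := ltgtP X a.
- left; have A0z : A0 a b z by right; rewrite /= -/X X0.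
  by case: i hi Xl => [//|i] _ Xl; split=> //; exact: Xl.
- right; have B0z : B0 a b z by right.
  case: j hj Xd Xu => [//|[|[|[|j]]]] // _ Xd Xu; split=> //=.
  + exact: Xd.
  + exact: Xu.
  + by apply/andP; split; [exact: Xd|exact: Xu].
- have [y1 y2] := andP (Xa E).
  left; have A0z : A0 a b z by left; rewrite /door /= -/X E y1 y2.
  by case: i hi Xl => [//|i] _ Xl; split.
Qed.

Lemma A_le i z : A_ a b i z -> xcoord z <= a.
Proof.
have K : A0 a b z -> xcoord z <= a by case=> [[->]//|/andP[_ /ltW]].
by case: i => [|i] //= [/K].
Qed.

Lemma B_ge j z : B_ a b j z -> a <= xcoord z.
Proof.
have K : B0 a b z -> a <= xcoord z by case=> [[->]//|/ltW].
by case: j => [|[|[|j]]] //= [/K].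
Qed.

Lemma cont_entry m n (F : R -> 'M[R]_(m, n)) k l :
  {within `[(0 : R), 1]%classic, continuous F} -> cont (fun t => F t k l).
Proof.
move=> cF t; apply: (@cvg_comp _ _ _ F (fun M : 'M[R]_(m, n) => M k l)).
  exact: cF.
exact: coord_continuous.
Qed.
Arguments cont_entry [m n F] k l _.

Lemma can_move_motion i j p q S : (i <= 1)%N -> (j <= 3)%N ->
  rectangle p q S -> can_move a b i j S ->
  exists x c s, motion a b (0 < i)%N (odd j) (1 < j)%N p q x c s.
Proof.
move=> hi hj [p0 q0 [g hg ->]] [Phi [cPhi hPhi PhiA PhiB PhiC]].
pose G t := ecomp (Phi t) g.
have hG t : 0 <= t <= 1 -> E2 (G t).
  by move=> ht; apply: E2_ecomp => //; apply: hPhi; rewrite in_itv.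
have GS t z : std p q z -> act (Phi t) (act g z) = act (G t) z.
  by rewrite act_ecomp.
have c1 : {within `[(0 : R), 1]%classic, continuous (fun t => (Phi t).1)}.
  by move=> t; apply: (@cvg_comp _ _ _ Phi fst); [exact: cPhi|exact: cvg_fst].
have c2 : {within `[(0 : R), 1]%classic, continuous (fun t => (Phi t).2)}.
  by move=> t; apply: (@cvg_comp _ _ _ Phi snd); [exact: cPhi|exact: cvg_snd].
have cM k : cont (fun t => (G t).1 0 k).
  rewrite (_ : (fun _ => _) =
      fun t => (Phi t).1 0 0 * g.1 0 k + (Phi t).1 0 1 * g.1 1 k).
    exact: (contD (contM (cont_entry 0 0 c1) (cont_cst _))
      (contM (cont_entry 0 1 c1) (cont_cst _))).
  by apply/funext => t; rewrite mulmx2E.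
have cv : cont (fun t => (G t).2 0 0).
  rewrite (_ : (fun _ => _) = fun t =>
      (Phi t).1 0 0 * g.2 0 0 + (Phi t).1 0 1 * g.2 1 0 + (Phi t).2 0 0).
    exact: (contD (contD (contM (cont_entry 0 0 c1) (cont_cst (g.2 0 0)))
      (contM (cont_entry 0 1 c1) (cont_cst (g.2 1 0)))) (cont_entry 0 0 c2)).
  by apply/funext => t; rewrite mxE mulmx2E.
exists (fun t => leftmost p q (G t)), (fun t => `|(G t).1 0 0|),
  (fun t => `|(G t).1 0 1|).
have W t : 0 <= t <= 1 -> 0 < p * `|(G t).1 0 0| + q * `|(G t).1 0 1|.
  move=> ht; apply: width_gt0 => //; have [e _ [E _ _]] := E2P (hG t ht).
  by rewrite !real_normK ?num_real.
have half (t : R) : 0 < t < 1 -> (0 < t * p < p) /\ (0 < t * q < q).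
  by move=> ht; split; exact: scale_in.
split.
- split; [|exact: cont_norm|exact: cont_norm].
  exact: (contD cv (contM (contD
    (contM (cont_cst p) (contB (cM 0) (cont_norm (cM 0))))
    (contM (cont_cst q) (contB (cM 1) (cont_norm (cM 1))))) (cont_cst 2^-1))).
- move=> t ht; have [e _ [E _ _]] := E2P (hG t ht).
  by split=> //; rewrite !real_normK ?num_real.
- move=> t ht; have [y [e [e1 H]]] := corner_form p q (hG t ht).
  exists y, e; split=> // B A hB hA; have [z hz [<- <-]] := H B A hB hA.
  apply/C_allowed => //; rewrite -GS //; apply: (PhiC t); first by rewrite in_itv.
  by exists (act g z) => //; exists z.
- have h0 : 0 <= (0 : R) <= 1 by rewrite lexx ler01.
  have [y [e [e1 H]]] := corner_form p q (hG 0 h0).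
  have w0 := W 0 h0; rewrite -subr_ge0.
  (* The added 1 makes the margin strictly positive inside the segment, although membership in the
     left part only gives [X <= a]. *)
  apply: (@segment_ge0 _ _ (a - leftmost p q (G 0) + 1)) => t ht.
  have ht' : 0 < 1 - t < 1 by lra.
  have [hp hq] := half _ ht'.
  have [z hz [E _]] := H _ _ hp hq.
  have : xcoord (act (G 0) z) <= a.
    by apply: (@A_le i); apply: PhiA; rewrite -GS //; exists (act g z) => //; exists z.
  rewrite E; lra.
have h1 : 0 <= (1 : R) <= 1 by rewrite lexx ler01.
have [y [e [e1 H]]] := corner_form p q (hG 1 h1).
have w0 := W 1 h1; rewrite -subr_ge0.
apply: (@segment_ge0 _ _ (leftmost p q (G 1) +
  (p * `|(G 1).1 0 0| + q * `|(G 1).1 0 1|) - a + 1)) => t ht.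
have [hp hq] := half _ ht.
have [z hz [E _]] := H _ _ hp hq.
have : a <= xcoord (act (G 1) z).
  by apply: (@B_ge j); apply: PhiB; rewrite -GS //; exists (act g z) => //; exists z.
rewrite E; lra.
Qed.

End Coordinates.

(** * Continuity of matrix-valued paths *)

Section MatrixPaths.
Variable R : realType.
Local Notation cont F := {within `[(0 : R), 1]%classic, continuous F}.

Lemma cont_mx m n (F : R -> 'M[R]_(m, n)) :
  (forall k l, cont (fun t => F t k l)) -> cont F.
Proof.
move=> H t A [P MP PA]; rewrite nbhs_filterE.
apply: filterS (_ : nbhs (t : subspace `[(0 : R), 1]%classic)
  (fun t' => forall k l, P k l (F t' k l))).
  by move=> t' Pt'; exact: PA.
apply: filter_forall => k; apply: filter_forall => l.
exact: H (MP k l).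
Qed.

Lemma cont_pair (T U : topologicalType) (F : R -> T) (G : R -> U) :
  {within `[(0 : R), 1]%classic, continuous F} ->
  {within `[(0 : R), 1]%classic, continuous G} ->
  {within `[(0 : R), 1]%classic, continuous (fun t => (F t, G t))}.
Proof. by move=> cF cG t; apply: cvg_pair; [exact: cF|exact: cG]. Qed.

End MatrixPaths.

(** * Building admissible paths from explicit formulas *)

Section Moving.
Variables (R : realType) (a b : R).
Hypotheses (a0 : 0 < a) (b0 : 0 < b).
Local Notation cont F := {within `[(0 : R), 1]%classic, continuous F}.

Definition frame (e x y c s : R) : 'M[R]_2 * plane R :=
  (\matrix_(i, j) (if i == 0 then (if j == 0 then c else s)
                   else (if j == 0 then - (e * s) else e * c)), pt x y).

Lemma E2_frame e x y c s : e = 1 \/ e = -1 -> c ^+ 2 + s ^+ 2 = 1 ->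
  E2 (frame e x y c s).
Proof.
move=> e1 cs; apply/matrixP => i j; rewrite mulmx2E !mxE.
have [->|->] := ord2P i; have [->|->] := ord2P j; rewrite /=; try lra.
by case: e1 => ->; lra.
Qed.

Definition einv (g : 'M[R]_2 * plane R) : 'M[R]_2 * plane R :=
  (g.1^T, - (g.1^T *m g.2)).

Lemma E2_trmx (g : 'M[R]_2 * plane R) : E2 g -> g.1^T *m g.1 = 1%:M.
Proof. by rewrite /E2 /= => /mulmx1C. Qed.

Lemma E2_einv g : E2 g -> E2 (einv g).
Proof. by move=> hg; rewrite /E2 /= trmxK E2_trmx. Qed.

Lemma act_einvK g z : E2 g -> act (einv g) (act g z) = z.
Proof.
move=> hg; rewrite /act /= mulmxDr mulmxA E2_trmx // mul1mx.
by rewrite addrK.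
Qed.

Lemma rectangleC (p q : R) S : rectangle p q S -> rectangle q p S.
Proof.
case=> p0 q0 [g hg ->].
pose f : 'M[R]_2 * plane R := frame (-1) 0 0 0 1.
have hf : E2 f by apply: E2_frame; [right|rewrite expr0n expr1n add0r].
have fE z : act f z = pt (ycoord z) (xcoord z).
  by apply: plane_eq;
    rewrite ?xcoord_act ?ycoord_act ?xcoord_pt ?ycoord_pt !mxE /=; lra.
split=> //; exists (ecomp g f); first exact: E2_ecomp.
have eqS z : act (ecomp g f) (pt (ycoord z) (xcoord z)) = act g z.
  by rewrite act_ecomp fE xcoord_pt ycoord_pt; congr (act g _); apply: plane_eq;
    rewrite ?xcoord_pt ?ycoord_pt.
apply/seteqP; split=> _ [z [hx hy] <-].
  by exists (pt (ycoord z) (xcoord z)); rewrite ?eqS //= xcoord_pt ycoord_pt.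
exists (pt (ycoord z) (xcoord z)); first by rewrite /= xcoord_pt ycoord_pt.
by rewrite act_ecomp fE.
Qed.

Lemma box_can_move i j p q S e (x y c s : R -> R) : (i <= 1)%N -> (j <= 3)%N ->
  rectangle p q S -> e = 1 \/ e = -1 ->
  cont x -> cont y -> cont c -> cont s ->
  (forall t, 0 <= t <= 1 -> [/\ 0 <= c t, 0 <= s t & c t ^+ 2 + s t ^+ 2 = 1]) ->
  (forall t, 0 <= t <= 1 -> box_allowed a b (0 < i)%N (odd j) (1 < j)%N p q
     (x t) (y t) (c t) (s t) e) ->
  x 0 + p * c 0 + q * s 0 <= a -> a <= x 1 ->
  can_move a b i j S.
Proof.
move=> hi hj [p0 q0 [g hg ->]] e1 cx cy cc cs Hcs H H0 H1.
have h0 : 0 <= (0 : R) <= 1 by rewrite lexx ler01.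
have h1 : 0 <= (1 : R) <= 1 by rewrite lexx ler01.
pose F t := frame e (x t) (y t) (c t) (s t).
pose Phi t := ecomp (F t) (einv g).
have PhiE t z : act (Phi t) (act g z) = act (F t) z.
  by rewrite act_ecomp act_einvK.
have FX t z : xcoord (act (F t) z) = x t + xcoord z * c t + ycoord z * s t.
  by rewrite xcoord_act /F /frame /= !mxE /=; lra.
have FY t z : ycoord (act (F t) z) = y t + e * (ycoord z * c t - xcoord z * s t).
  by rewrite ycoord_act /F /frame /= !mxE /=; lra.
have inC t : 0 <= t <= 1 -> forall z, std p q z -> C_ a b i j (act (F t) z).
  move=> ht z [hx hy]; apply/C_allowed => //; rewrite FX FY.
  exact: H.
have cM k m : cont (fun t => (F t).1 k m).
  rewrite (_ : (fun _ => _) = fun t =>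
      if k == 0 then (if m == 0 then c t else s t)
      else (if m == 0 then - (e * s t) else e * c t)); last first.
    by apply/funext => t; rewrite mxE.
  case: (k == 0); case: (m == 0) => //.
    exact: (contN (contM (cont_cst e) cs)).
  exact: (contM (cont_cst e) cc).
have cv k l : cont (fun t => (F t).2 k l).
  rewrite (_ : (fun _ => _) = fun t => if k == 0 then x t else y t); last first.
    by apply/funext => t; rewrite mxE.
  by case: (k == 0).
exists Phi; split.
- apply: cont_pair; apply: cont_mx => k l.
    rewrite (_ : (fun _ => _) = fun t =>
        (F t).1 k 0 * (einv g).1 0 l + (F t).1 k 1 * (einv g).1 1 l); last first.
      by apply/funext => t; rewrite mulmx2E.
    exact: (contD (contM (cM k 0) (cont_cst _)) (contM (cM k 1) (cont_cst _))).
  rewrite (_ : (fun _ => _) = fun t =>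
      (F t).1 k 0 * (einv g).2 0 l + (F t).1 k 1 * (einv g).2 1 l + (F t).2 k l).
    exact: (contD (contD (contM (cM k 0) (cont_cst _))
      (contM (cM k 1) (cont_cst _))) (cv k l)).
  by apply/funext => t; rewrite mxE mulmx2E.
- move=> t; rewrite in_itv => ht; apply: E2_ecomp; last exact: E2_einv.
  by apply: E2_frame => //; case: (Hcs t ht).
- move=> _ [_ [z hz <-] <-]; rewrite PhiE.
  (* A point of the corridor outside the left part would have [X >= a], but points of the open
     rectangle are strictly left of its rightmost corner. *)
  have := inC 0 h0 z hz; case=> // /B_ge; rewrite FX; case: hz => hx hy.
  have [c1 s1 cs1] := Hcs 0 h0; have w0 := width_gt0 p0 q0 c1 s1 cs1.
  have k1 : 0 <= (p - xcoord z) * c 0 by apply: mulr_ge0 => //; lra.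
  have k2 : 0 <= (q - ycoord z) * s 0 by apply: mulr_ge0 => //; lra.
  have : 0 < (p - xcoord z) * c 0 + (q - ycoord z) * s 0 by apply: width_gt0 => //; lra.
  lra.
- move=> _ [_ [z hz <-] <-]; rewrite PhiE.
  have := inC 1 h1 z hz; case=> // /A_le; rewrite FX; case: hz => hx hy.
  have [c1 s1 cs1] := Hcs 1 h1.
  have : 0 < xcoord z * c 1 + ycoord z * s 1 by apply: width_gt0 => //; lra.
  lra.
move=> t; rewrite in_itv => ht _ [_ [z hz <-] <-]; rewrite PhiE.
exact: inC.
Qed.

(* The side [q] first turns from the vertical to the sine [s1], with [K = 0];
   then the rectangle is translated, [K] growing from [0] to [1]. *)
Lemma two_phase i j p q S e s1 (x y : R -> R -> R -> R) :
  (i <= 1)%N -> (j <= 3)%N -> rectangle p q S -> e = 1 \/ e = -1 -> 0 <= s1 <= 1 ->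
  (forall C T K : R -> R, cont C -> cont T -> cont K ->
    cont (fun t => x (C t) (T t) (K t)) /\ cont (fun t => y (C t) (T t) (K t))) ->
  (forall C T, 0 <= C -> 0 <= T <= s1 -> C ^+ 2 + T ^+ 2 = 1 ->
    box_allowed a b (0 < i)%N (odd j) (1 < j)%N p q (x C T 0) (y C T 0) C T e) ->
  (forall C K, 0 <= C -> 0 <= K <= 1 -> C ^+ 2 + s1 ^+ 2 = 1 ->
    box_allowed a b (0 < i)%N (odd j) (1 < j)%N p q (x C s1 K) (y C s1 K) C s1 e) ->
  x 1 0 0 + p <= a ->
  (forall C, 0 <= C -> C ^+ 2 + s1 ^+ 2 = 1 -> a <= x C s1 1) ->
  can_move a b i j S.
Proof.
move=> hi hj rS e1 hs cxy H1 H2 Hstart Hend.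
(* [t + t - K t] is the minimum of [2 t] and 1: the turn fills the first half of the time and the
   translation the second, with no gluing of paths. *)
pose K t : R := Num.max 0 (t + t - 1).
pose T t : R := s1 * (t + t - K t).
pose C t : R := Num.sqrt (1 - T t * T t).
have cid : cont (fun t : R => t) by apply: continuous_subspaceT => t; exact: cvg_id.
have cK : cont K.
  exact: (cont_max (cont_cst 0) (contB (contD cid cid) (cont_cst 1))).
have cT : cont T by exact: (contM (cont_cst s1) (contB (contD cid cid) cK)).
have cC : cont C.
  move=> t; apply: (@cvg_comp _ _ _ (fun t => 1 - T t * T t) Num.sqrt).
    exact: (contB (cont_cst 1) (contM cT cT)).
  exact: sqrt_continuous.
have [cx cy] := cxy _ _ _ cC cT cK.
have phase t : 0 <= t <= 1 -> (K t = 0 /\ 0 <= T t <= s1) \/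
    (T t = s1 /\ 0 <= K t <= 1).
  move=> ht; rewrite /T /K; have [le|le] := boolP (t + t - 1 <= 0).
    rewrite max_l //; left; split=> //; apply/andP; split.
      by apply: mulr_ge0; lra.
    by rewrite ler_piMr; lra.
  have {}le : 0 <= t + t - 1 by rewrite -ltNge in le; exact: ltW.
  rewrite max_r //; right; split; last by lra.
  by rewrite (_ : t + t - _ = 1) ?mulr1 //; lra.
have Tin t : 0 <= t <= 1 -> 0 <= T t <= s1.
  by move=> ht; case: (phase t ht) => [[]//|[-> _]]; lra.
have CT t : 0 <= t <= 1 -> [/\ 0 <= C t, 0 <= T t & C t ^+ 2 + T t ^+ 2 = 1].
  move=> /Tin hT; split; [exact: sqrtr_ge0|by lra|].
  rewrite sqr_sqrtr; first by lra.
  have : 0 <= (1 - T t) * (1 + T t) by apply: mulr_ge0; lra.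
  lra.
have h0 : 0 <= (0 : R) <= 1 by rewrite lexx ler01.
have h1 : 0 <= (1 : R) <= 1 by rewrite lexx ler01.
have K0 : K 0 = 0 by rewrite /K max_l //; lra.
have T0 : T 0 = 0 by rewrite /T K0; lra.
have C0 : C 0 = 1 by rewrite /C T0 mul0r subr0 sqrtr1.
have K1 : K 1 = 1 by rewrite /K max_r; lra.
have T1 : T 1 = s1 by rewrite /T K1; lra.
apply: (box_can_move hi hj rS e1 cx cy cC cT CT).
- move=> t ht; have [c1 t1 ct] := CT t ht.
  case: (phase t ht) => [[-> hT]|[TE hK]]; first exact: H1.
  by rewrite TE in ct *; exact: H2.
- by rewrite C0 T0 K0; lra.
by have [c1 t1] := CT 1 h1; rewrite T1 K1; exact: Hend.
Qed.

End Moving.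

(** * Admissible positions of a rectangle of maximal area *)

Section Boxes.
Variables (R : realType) (a b : R).
Hypotheses (a0 : 0 < a) (b0 : 0 < b).
Implicit Types (L D U : bool) (c k s X Y : R).
Local Notation allowed := (allowed a b).
Local Notation box_allowed := (box_allowed a b).

Lemma allowed_of L D U X Y :
  0 < X -> (L -> 0 < Y) -> (a <= X -> 0 < Y < b) -> allowed L D U X Y.
Proof.
move=> X0 Yl Yr; split=> //.
- by move=> E; apply: Yr; rewrite E.
- by move=> /ltW/Yr/andP[].
by move=> /ltW/Yr/andP[].
Qed.

(** The reflection in [Y = b / 2] preserves the door and exchanges the floor and the ceiling on the
    right. *)
Lemma box_reflect D U p q x y c s e : box_allowed false D U p q x y c s e ->
  box_allowed false U D p q x (b - y) c s (- e).
Proof.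
move=> H B A hB hA; have [X0 Xa Xl Xd Xu] := H B A hB hA.
rewrite (_ : b - y + _ = b - (y + e * (A * c - B * s))); last by ring.
split=> // [E|lt u|lt d].
- by have := Xa E; lra.
- by have := Xu lt u; lra.
by have := Xd lt d; lra.
Qed.

Variables (p q sn : R).
Hypotheses (p0 : 0 < p) (q0 : 0 < q).
Hypotheses (s0 : 0 < sn) (Ep : p = b * sn) (Eq : q * sn = a) (pa : p <= a).

Section Angle.
Variables (c s : R).
Hypotheses (c1 : 0 <= c) (s1 : 0 <= s) (cs : c ^+ 2 + s ^+ 2 = 1).

Lemma angle_gt0 B A : 0 < B -> 0 < A -> 0 < B * c + A * s.
Proof. by move=> B0 A0; apply: width_gt0. Qed.

Lemma unit_scale r : r * c ^+ 2 + r * s ^+ 2 = r.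
Proof. by rewrite -mulrDr cs mulr1. Qed.

(** For [s = 0] the width is [p <= a], so no point reaches the door. Elsewhere heights may be
    compared after multiplication by [s]. *)
Lemma sin_gt0 B A : 0 < B < p -> a <= B * c + A * s -> 0 < s.
Proof.
move=> hB; rewrite lt_def s1 andbT; apply: contraTN => /eqP sE.
have c_1 : c = 1.
  move: cs; rewrite sE expr0n addr0 => /eqP; rewrite sqrf_eq1.
  by have := c1; move=> ? /orP[] /eqP; lra.
by rewrite sE c_1 -ltNge; have := pa; lra.
Qed.

(* The leftmost corner is on [X = 0], the rightmost one at height [b c^2]. *)
Lemma box_descend D U : b <= q -> s <= sn ->
  box_allowed false D U p q 0 (b * c ^+ 2 - q * c + p * s) c s 1.
Proof.
move=> bq ssn B A hB hA; apply: allowed_of => //.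
  by rewrite add0r; apply: angle_gt0; lra.
rewrite add0r => aX; have s_0 := sin_gt0 hB aX.
have b1 := b0; have c1' := c1; have s1' := s1.
have cle : c <= 1 by have := cs; nra.
have k0 : 0 <= (sn - s) * (q - b * c).
  apply: mulr_ge0; first lra.
  have : 0 <= b * (1 - c) by apply: mulr_ge0; lra.
  lra.
(* The part beyond [X = a] is within [b * s * c] of the rightmost corner. That is the altitude of a
   right triangle with the door as hypotenuse, which its foot divides into [b * c ^+ 2] and
   [b * s ^+ 2]: hence the height chosen for this corner. *)
have h1 : (q - A) * s <= b * s * c - (p - B) * c.
  have := Ep; have := Eq => e1 e2.
  have : p * c = b * sn * c by rewrite {1}Ep.
  lra.
have U1 := unit_scale b; have U2 := unit_scale (p - B); have U3 := unit_scale (q - A).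
set Y := _ + _.
have hY : Y = b * c ^+ 2 - (q - A) * c + (p - B) * s by rewrite /Y; ring.
have n1 : 0 <= c * (b * s * c - (p - B) * c - (q - A) * s) by apply: mulr_ge0; lra.
have n2 : 0 <= s * (b * s * c - (p - B) * c - (q - A) * s) by apply: mulr_ge0; lra.
have sY : 0 < s * Y by rewrite hY; lra.
have cY : 0 < c * (b - Y).
  have U4 : c * (b * c ^+ 2) + c * (b * s ^+ 2) = c * b by rewrite -mulrDr U1.
  by rewrite hY; lra.
rewrite (pmulr_rgt0 _ s_0) in sY; rewrite sY /=.
rewrite -subr_gt0 ltNge; apply/negP => le.
have : 0 <= c * - (b - Y) by apply: mulr_ge0; lra.
lra.
Qed.

(** The left side is the vertical distance to the corner after [q]. Multiplied by [s], its margin to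
    [b] is at least [(s - sn) * (b - q * c) + (p - B)], by [a <= B * c + A * s]. *)
Lemma slide_bound B A : 0 < B < p -> a <= B * c + A * s ->
  0 <= (s - sn) * (b - q * c) -> (q - A) * c + B * s < b.
Proof.
move=> hB aX k0; have s_0 := sin_gt0 hB aX.
have c1' := c1.
rewrite -subr_gt0 -(pmulr_rgt0 _ s_0).
have n1 : 0 <= c * (B * c + A * s - a) by apply: mulr_ge0; lra.
have U1 := unit_scale B.
have e1 : a * c = q * sn * c by rewrite Eq.
have e2 := Ep.
lra.
Qed.

(* The leftmost corner is on [X = 0], the highest one on [Y = b]. *)
Lemma box_hang D U : 0 <= (s - sn) * (b - q * c) ->
  box_allowed false D U p q 0 (b - q * c) c s 1.
Proof.
move=> k0 B A hB hA; apply: allowed_of => //.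
  by rewrite add0r; apply: angle_gt0; lra.
rewrite add0r => aX; have := slide_bound hB aX k0.
have : 0 < (q - A) * c + B * s.
  by apply: width_gt0 => //; lra.
lra.
Qed.

(* The leftmost corner is on [X = 0], the lowest one on [Y = 0]. *)
Lemma box_lean L D U : 0 <= (s - sn) * (b - q * c) ->
  box_allowed L D U p q 0 (q * c) c s (-1).
Proof.
move=> k0 B A hB hA.
have Y0 : 0 < q * c + -1 * (A * c - B * s).
  rewrite (_ : _ + _ = (q - A) * c + B * s); last by ring.
  by apply: width_gt0 => //; lra.
apply: allowed_of => //.
  by rewrite add0r; apply: angle_gt0; lra.
rewrite add0r => aX; have := slide_bound hB aX k0; lra.
Qed.

End Angle.

Section Slide.
Variables (c k : R).
Hypotheses (c1 : 0 <= c) (cs : c ^+ 2 + sn ^+ 2 = 1) (k1 : 0 <= k).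

Let U r : r * c ^+ 2 + r * sn ^+ 2 = r.
Proof. by rewrite -mulrDr cs mulr1. Qed.

Let X_gt0 B A : 0 < B < p -> 0 < A < q -> 0 < q * k * sn + B * c + A * sn.
Proof.
move=> hB hA.
have := width_gt0 (p := B) (q := A) ltac:(lra) ltac:(lra) c1 (ltW s0) cs.
have : 0 <= q * k * sn by rewrite !mulr_ge0 ?(ltW q0) ?(ltW s0).
lra.
Qed.

(** At the critical angle the two sides [q] lie on lines through the two ends of the door, and the
    rectangle slides upwards between these lines. *)
Lemma box_push D : box_allowed false D false p q (q * k * sn)
  (b * c ^+ 2 + q * k * c - q * c + p * sn) c sn 1.
Proof.
move=> B A hB hA; have c1' := c1; have e2 := Ep; have e1 := Eq.
have U1 := U b; have U2 := U (p - B); have U3 := U B; have Up := U p.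
have Us : sn * (b * c ^+ 2) + sn * (b * sn ^+ 2) = sn * b by rewrite -mulrDr U1.
set X := _ + _ + _; set Y := _ + 1 * _.
have hY : Y = b * c ^+ 2 + (q * k - (q - A)) * c + (p - B) * sn by rewrite /Y; ring.
have hX : X = a + (q * k - (q - A)) * sn + B * c by rewrite /X -Eq; ring.
have E3 : p * c ^+ 2 = b * sn * c ^+ 2 by rewrite {1}Ep.
have E4 : p * sn ^+ 2 = b * sn * sn ^+ 2 by rewrite {1}Ep.
have Y0 : a <= X -> 0 < Y.
  rewrite hX => aX; rewrite -(pmulr_rgt0 _ s0) hY.
  have n1 : 0 <= c * ((q * k - (q - A)) * sn + B * c) by apply: mulr_ge0; lra.
  lra.
split=> //.
- exact: X_gt0.
- move=> E; rewrite Y0 ?E //=.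
  have z : c * ((q * k - (q - A)) * sn + B * c) = 0.
    by apply/eqP; rewrite mulf_eq0; apply/orP; right; apply/eqP; rewrite hX in E; lra.
  rewrite -subr_gt0 -(pmulr_rgt0 _ s0) hY; lra.
by move=> /ltW/Y0.
Qed.

(** The mirror image slides downwards between lines through the ends of the door; left of the door
    it remains above the floor. *)
Lemma box_slip L U' : box_allowed L false U' p q (q * k * sn)
  (q * c - q * k * c) c sn (-1).
Proof.
move=> B A hB hA; have c1' := c1; have e2 := Ep; have e1 := Eq.
have U3 := U B.
set X := _ + _ + _; set Y := _ + -1 * _.
have hY : Y = ((q - A) - q * k) * c + B * sn by rewrite /Y; ring.
have hX : X = a + (q * k - (q - A)) * sn + B * c by rewrite /X -Eq; ring.
have Y0 : X <= a -> 0 < Y.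
  rewrite hX => aX; rewrite -(pmulr_rgt0 _ s0) hY.
  have n1 : 0 <= c * (- (q * k - (q - A)) * sn - B * c) by apply: mulr_ge0; lra.
  lra.
have Yb : a <= X -> Y < b.
  rewrite hX => aX; rewrite -subr_gt0 -(pmulr_rgt0 _ s0) hY.
  have n1 : 0 <= c * ((q * k - (q - A)) * sn + B * c) by apply: mulr_ge0; lra.
  lra.
split=> //.
- exact: X_gt0.
- by move=> E; rewrite Y0 ?Yb ?E.
- by move=> /ltW/Y0.
by move=> /ltW/Yb.
Qed.

End Slide.

Lemma box_level L D U c x y e : c = 0 -> 0 <= x ->
    (forall B, 0 < B < p -> 0 < y - e * B < b) ->
  box_allowed L D U p q x y c 1 e.
Proof.
move=> -> x0 hy B A hB hA; have /andP[h1 h2] := hy B hB.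
by apply: allowed_of => [||_]; [lra| |]; rewrite (_ : y + _ = y - e * B) ?h1 //; ring.
Qed.

End Boxes.

(** * The motions that realize the maximal rectangles *)

Section Sufficiency.
Variables (R : realType) (a b : R).
Hypotheses (a0 : 0 < a) (b0 : 0 < b).
Local Notation cont F := {within `[(0 : R), 1]%classic, continuous F}.

Lemma translate_can_move i j S : (i <= 1)%N -> (j <= 3)%N ->
  rectangle a b S -> can_move a b i j S.
Proof.
have a1 := a0; move=> hi hj rS.
have box C K : 0 <= C -> 0 <= K -> C ^+ 2 + 0 ^+ 2 = 1 ->
    box_allowed a b (0 < i)%N (odd j) (1 < j)%N a b (a * K) 0 C 0 1.
  move=> C0 K0; rewrite expr0n addr0 => /eqP; rewrite sqrf_eq1 => C1.
  have {}C1 : C = 1 by case/orP: C1 => /eqP; lra.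
  have aK : 0 <= a * K by rewrite mulr_ge0 // ltW.
  by move=> B A hB hA; rewrite C1; apply: allowed_of; lra.
have h00 : 0 <= (0 : R) <= 1 by rewrite lexx ler01.
(* With [s1 = 0] the turning phase is constant and the motion is a horizontal translation. *)
apply: (two_phase (e := 1) (s1 := 0) (x := fun C T K => a * K) (y := fun C T K => 0)
  a0 hi hj rS) => //; first by left.
- by move=> C T K cC cT cK; split; [exact: (contM (cont_cst a) cK)|exact: cont_cst].
- move=> C T C0 hT; have -> : T = 0 by lra.
  exact: box.
- by move=> C K C0 /andP[K0 _]; exact: box.
- by lra.
by move=> C _ _; rewrite mulr1.
Qed.

Variables (p q sn : R).
Hypotheses (s0 : 0 < sn <= 1) (Ep : p = b * sn) (Eq : q * sn = a) (pa : p <= a).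

Let sn0 : 0 < sn. Proof. by case/andP: s0. Qed.
Let p0 : 0 < p. Proof. by rewrite Ep mulr_gt0. Qed.
Let q0 : 0 < q. Proof. by rewrite -(pmulr_lgt0 _ sn0) Eq. Qed.
Let pb : p <= b. Proof. by case/andP: s0 => _ s1; rewrite Ep ler_piMr // ltW. Qed.
Let bq : b <= q.
Proof. by rewrite -(ler_pM2r sn0) Eq -Ep. Qed.

Let qc2 c s : c ^+ 2 + s ^+ 2 = 1 -> (q * c) ^+ 2 = q ^+ 2 - (q * s) ^+ 2.
Proof. by move=> cs; rewrite !exprMn -[X in X - _]mulr1 -cs; ring. Qed.

(** Since [q * s <= a], a side [q >= l] has [q * c >= b], and both factors are nonpositive;
    [short_side] is the opposite case. They provide the sign condition of [slide_bound]. *)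
Let long_side c s : 0 <= c -> 0 <= s <= sn -> c ^+ 2 + s ^+ 2 = 1 ->
  a ^+ 2 + b ^+ 2 <= q ^+ 2 -> 0 <= (s - sn) * (b - q * c).
Proof.
move=> c0 hs cs hq; have qs : 0 <= q * s by rewrite mulr_ge0 ?(ltW q0) //; lra.
have qsa : (q * s) ^+ 2 <= a ^+ 2.
  by rewrite ler_pXn2r ?nnegrE ?(ltW a0) // -Eq ler_pM2l //; lra.
have qc : b <= q * c.
  rewrite -(@ler_pXn2r _ 2) ?nnegrE ?(ltW b0) //; first by rewrite (qc2 cs); lra.
  by rewrite mulr_ge0 // ltW.
by rewrite -mulrNN mulr_ge0; lra.
Qed.

Let short_side c s : 0 <= c -> sn <= s -> c ^+ 2 + s ^+ 2 = 1 ->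
  q ^+ 2 <= a ^+ 2 + b ^+ 2 -> 0 <= (s - sn) * (b - q * c).
Proof.
move=> c0 hs cs hq.
have qsa : a ^+ 2 <= (q * s) ^+ 2.
  rewrite ler_pXn2r ?nnegrE ?(ltW a0) //; first by rewrite -Eq ler_pM2l.
  by apply: mulr_ge0; [exact: ltW|apply: le_trans hs; exact: ltW].
have qc : q * c <= b.
  rewrite -(@ler_pXn2r _ 2) ?nnegrE ?(ltW b0) //; first by rewrite (qc2 cs); lra.
  by rewrite mulr_ge0 // ltW.
by rewrite mulr_ge0; lra.
Qed.

Let cont_sqr (C : R -> R) : cont C -> cont (fun t => C t ^+ 2).
Proof. by move=> cC; exact: (contM cC cC). Qed.

Let cont_push (C T K : R -> R) : cont C -> cont T -> cont K ->
  cont (fun t => q * K t * T t) /\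
  cont (fun t => b * C t ^+ 2 + q * K t * C t - q * C t + p * T t).
Proof.
move=> cC cT cK; have cqK : cont (fun t => q * K t) := contM (cont_cst q) cK.
split; first exact: (contM cqK cT).
exact: (contD (contB (contD (contM (cont_cst b) (cont_sqr cC)) (contM cqK cC))
  (contM (cont_cst q) cC)) (contM (cont_cst p) cT)).
Qed.

Let push_start C T : q * 0 * T = 0 /\
  b * C ^+ 2 + q * 0 * C - q * C + p * T = b * C ^+ 2 - q * C + p * T.
Proof. by split; ring. Qed.

Lemma push_can_move j S : j \in [:: 0; 1; 2]%N -> rectangle p q S ->
  can_move a b 0 j S.
Proof.
have pa' := pa; have s01 : 0 <= sn <= 1 by have := s0; lra.
rewrite !inE => hj rS; have hj3 : (j <= 3)%N by case/or3P: hj => /eqP ->.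
(* With a ceiling but no floor on the right, the upward motion is reflected. *)
have [hjU|hjU] := boolP (1 < j)%N.
  have jD : odd j = false by case/or3P: hj hjU => /eqP ->.
  apply: (two_phase (e := -1) (s1 := sn) (x := fun C T K => q * K * T)
    (y := fun C T K => b - (b * C ^+ 2 + q * K * C - q * C + p * T))
    a0 (leq0n 1) hj3 rS) => //; first by right.
  - move=> C T K cC cT cK; have [? cy] := cont_push cC cT cK; split=> //.
    exact: (contB (cont_cst b) cy).
  - move=> C T C0 /andP[T0 Tn] CT; rewrite hjU jD; apply: box_reflect.
    have [-> ->] := push_start C T.
    exact: (box_descend b0 Ep Eq pa C0 T0 CT).
  - move=> C K C0 /andP[K0 K1] CT; rewrite hjU jD; apply: box_reflect.
    exact: (box_push q0 sn0 Ep Eq C0 CT K0).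
  - by lra.
  by move=> C _ _; rewrite mulr1 Eq.
apply: (two_phase (e := 1) (s1 := sn) (x := fun C T K => q * K * T)
  (y := fun C T K => b * C ^+ 2 + q * K * C - q * C + p * T)
  a0 (leq0n 1) hj3 rS) => //; first by left.
- move=> C T C0 /andP[T0 Tn] CT; have [-> ->] := push_start C T.
  exact: (box_descend b0 Ep Eq pa C0 T0 CT).
- move=> C K C0 /andP[K0 K1] CT; rewrite (negbTE hjU).
  exact: (box_push q0 sn0 Ep Eq C0 CT K0).
- by lra.
by move=> C _ _; rewrite mulr1 Eq.
Qed.

Let cos0 (C : R) : C ^+ 2 + 1 ^+ 2 = 1 -> C = 0.
Proof. by move=> CT; apply/eqP; rewrite -sqrf_eq0; apply/eqP; lra. Qed.

Lemma hang_can_move j S : (j <= 3)%N -> q ^+ 2 <= a ^+ 2 + b ^+ 2 ->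
  rectangle p q S -> can_move a b 0 j S.
Proof.
have pa' := pa; have a1 := a0; have pb' := pb.
have h11 : 0 <= (1 : R) <= 1 by rewrite lexx ler01.
move=> hj hq rS.
(* [T + sn - Num.max T sn] is the minimum of [T] and [sn], so this height follows [box_descend] up
   to the critical angle and [box_hang] after it. *)
apply: (two_phase (e := 1) (s1 := 1) (x := fun C T K => a * K)
  (y := fun C T K => b - b * T * (T + sn - Num.max T sn) - q * C + p * T)
  a0 (leq0n 1) hj rS) => //; first by left.
- move=> C T K cC cT cK; split; first exact: (contM (cont_cst a) cK).
  exact: (contD (contB (contB (cont_cst b) (contM (contM (cont_cst b) cT)
    (contB (contD cT (cont_cst sn)) (cont_max cT (cont_cst sn)))))
    (contM (cont_cst q) cC)) (contM (cont_cst p) cT)).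
- move=> C T C0 /andP[T0 T1] CT; rewrite mulr0.
  have [le|le] := boolP (T <= sn).
    rewrite max_r // (_ : b - _ - _ + _ = b * C ^+ 2 - q * C + p * T).
      exact: (box_descend b0 Ep Eq pa C0 T0 CT).
    have -> : C ^+ 2 = 1 - T ^+ 2 by lra.
    by ring.
  have {}le : sn <= T by rewrite -ltNge in le; exact: ltW.
  rewrite max_l // (_ : b - _ - _ + _ = b - q * C).
    exact: (box_hang Ep Eq pa C0 T0 CT _ _ (short_side C0 le CT hq)).
  by rewrite Ep; ring.
- move=> C K C0 /andP[K0 K1] CT; have C_0 := cos0 CT.
  apply: box_level => //; first by rewrite mulr_ge0 // ltW.
  move=> B hB; rewrite C_0 max_l; last by have := s0; lra.
  by rewrite (_ : b - _ - _ + _ - _ = b - B); [lra|rewrite Ep; ring].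
- by lra.
by move=> C _ _; rewrite mulr1.
Qed.

Lemma slip_can_move j S : j \in [:: 0; 2]%N -> a ^+ 2 + b ^+ 2 <= q ^+ 2 ->
  rectangle p q S -> can_move a b 1 j S.
Proof.
have pa' := pa; have s01 : 0 <= sn <= 1 by have := s0; lra.
rewrite !inE => hj hq rS; have hj3 : (j <= 3)%N by case/orP: hj => /eqP ->.
have jD : odd j = false by case/orP: hj => /eqP ->.
apply: (two_phase (e := -1) (s1 := sn) (x := fun C T K => q * K * T)
  (y := fun C T K => q * C - q * K * C) a0 (leqnn 1) hj3 rS) => //; first by right.
- move=> C T K cC cT cK; have cqK : cont (fun t => q * K t) := contM (cont_cst q) cK.
  split; first exact: (contM cqK cT).
  exact: (contB (contM (cont_cst q) cC) (contM cqK cC)).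
- move=> C T C0 hT CT; have [T0 Tn] := andP hT.
  rewrite mulr0 !mul0r subr0.
  exact: (box_lean Ep Eq pa C0 T0 CT _ _ _ (long_side C0 hT CT hq)).
- move=> C K C0 /andP[K0 K1] CT; rewrite jD.
  exact: (box_slip q0 sn0 Ep Eq C0 CT K0).
- by lra.
by move=> C _ _; rewrite mulr1 Eq.
Qed.

(** For [q = l] both sign conditions hold, so the rectangle passes the critical angle while leaning
    on the floor and then moves horizontally. *)
Lemma lean_can_move j S : (j <= 3)%N -> q ^+ 2 = a ^+ 2 + b ^+ 2 ->
  rectangle p q S -> can_move a b 1 j S.
Proof.
have pa' := pa; have a1 := a0; have pb' := pb.
have h11 : 0 <= (1 : R) <= 1 by rewrite lexx ler01.
move=> hj hq rS.
apply: (two_phase (e := -1) (s1 := 1) (x := fun C T K => a * K)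
  (y := fun C T K => q * C) a0 (leqnn 1) hj rS) => //; first by right.
- move=> C T K cC cT cK; split; first exact: (contM (cont_cst a) cK).
  exact: (contM (cont_cst q) cC).
- move=> C T C0 /andP[T0 T1] CT; rewrite mulr0.
  apply: (box_lean Ep Eq pa C0 T0 CT).
  have [le|le] := leP T sn; first by apply: long_side => //; rewrite ?T0 ?hq.
  by apply: short_side; rewrite ?hq // ltW.
- move=> C K C0 /andP[K0 K1] CT; have C_0 := cos0 CT.
  apply: box_level => //; first by rewrite mulr_ge0 // ltW.
  by move=> B hB; rewrite C_0; lra.
- by lra.
by move=> C _ _; rewrite mulr1.
Qed.

End Sufficiency.

(** * The maximal area and the classification of maximal rectangles *)

Section MaximalRectangles.
Variables (R : realType) (a b : R).
Hypotheses (a0 : 0 < a) (b0 : 0 < b).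
Implicit Types (i j : nat) (p q d : R).

Lemma rectangle_area_le i j p q S : (i <= 1)%N -> (j <= 3)%N ->
  rectangle p q S -> can_move a b i j S -> p * q <= a * b.
Proof.
move=> hi hj rS mS; have [p0 q0 _] := rS.
have [x [c [s mot]]] := can_move_motion a0 hi hj rS mS.
have [tau [cro|cro]] := last_crossing p0 q0 mot; have [ht EM _ _] := cro.
  exact: (touching_area b0 p0 q0 mot ht EM (crossing_p p0 q0 mot cro)).
rewrite mulrC.
exact: (touching_area b0 q0 p0 (motionC mot) ht EM
  (crossing_p q0 p0 (motionC mot) cro)).
Qed.

(** The bound by [a] comes from the initial position, the bound by [b] from the chord in the
    door. *)
Lemma short_side_le i j p q S : (i <= 1)%N -> (j <= 3)%N ->
  rectangle p q S -> can_move a b i j S -> Num.min p q <= Num.min a b.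
Proof.
move=> hi hj rS mS; have [p0 q0 _] := rS.
have [x [c [s mot]]] := can_move_motion a0 hi hj rS mS.
rewrite le_min (motion_start_min p0 q0 mot) /= ge_min; apply/orP.
have [tau [cro|cro]] := last_crossing p0 q0 mot; have [ht EM _ _] := cro.
  by left; exact: (touching_pb b0 mot ht (crossing_p p0 q0 mot cro)).
by right; exact: (touching_pb b0 (motionC mot) ht (crossing_p q0 p0 (motionC mot) cro)).
Qed.

Lemma exists_translate i j : (i <= 1)%N -> (j <= 3)%N ->
  exists2 S, rectangle a b S & can_move a b i j S.
Proof.
move=> hi hj; pose S := act (1%:M, 0) @` std a b.
have rS : rectangle a b S.
  by split=> //; exists (1%:M, 0) => //; rewrite /E2 /= mul1mx trmx1.
by exists S => //; exact: translate_can_move.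
Qed.

Lemma max_area_corner i j : (i <= 1)%N -> (j <= 3)%N ->
  is_max_area (R_ a b i j) (a * b).
Proof.
move=> hi hj; split.
  have [S rS mS] := exists_translate hi hj.
  by exists S; [split=> //; exists a, b|exists a, b].
by move=> S m [_ mS] [p [q [rS ->]]]; exact: (rectangle_area_le hi hj rS mS).
Qed.

Lemma max_area_rectanglesP i j S : (i <= 1)%N -> (j <= 3)%N ->
  max_area_rectangles (R_ a b i j) S <->
  can_move a b i j S /\ exists p q, rectangle p q S /\ p * q = a * b.
Proof.
move=> hi hj; have [[S0 F0 m0] ub] := max_area_corner hi hj; split.
  move=> [[_ mS] [m [_ maxm] [p [q [rS Em]]]]]; split=> //; exists p, q; split=> //.
  apply/eqP; rewrite eq_le (rectangle_area_le hi hj rS mS) -Em.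
  exact: maxm F0 m0.
move=> [mS [p [q [rS E]]]]; split; first by split=> //; exists p, q.
exists (a * b); first exact: max_area_corner.
by exists p, q.
Qed.

Lemma rectangle_div p q S : p * q = a * b -> rectangle p q S ->
  rectangle (a * b / p) p S.
Proof.
move=> E rS; have [p0 _ _] := rS.
by rewrite -E mulrAC divff ?gt_eqF // mul1r; exact: rectangleC.
Qed.

(** [d / b] is the critical sine of the rectangle with sides [d] and [a * b / d]. *)
Lemma short_side_sin d : 0 < d -> d <= b ->
  [/\ 0 < d / b <= 1, d = b * (d / b) & a * b / d * (d / b) = a].
Proof.
move=> d0 db; split; first by rewrite divr_gt0 //= ler_pdivrMr // mul1r.
  by rewrite mulrCA divff ?gt_eqF // mulr1.
by field; rewrite !gt_eqF.
Qed.

Let l := Num.sqrt (a ^+ 2 + b ^+ 2).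
Let h := a * b / l.

Lemma diagonal_sqr : l ^+ 2 = a ^+ 2 + b ^+ 2.
Proof. by rewrite sqr_sqrtr // addr_ge0 ?sqr_ge0. Qed.

Lemma diagonal_gt0 : 0 < l.
Proof. by rewrite sqrtr_gt0 addr_gt0 // exprn_gt0. Qed.

Lemma altitude_gt0 : 0 < h.
Proof. by rewrite divr_gt0 ?mulr_gt0 // diagonal_gt0. Qed.

Lemma altitude_le : h <= a /\ h <= b.
Proof.
have la : a <= l.
  rewrite -(@ler_pXn2r _ 2) ?nnegrE ?(ltW a0) ?(ltW diagonal_gt0) //.
  by rewrite diagonal_sqr lerDl sqr_ge0.
have lb : b <= l.
  rewrite -(@ler_pXn2r _ 2) ?nnegrE ?(ltW b0) ?(ltW diagonal_gt0) //.
  by rewrite diagonal_sqr lerDr sqr_ge0.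
have l0 := diagonal_gt0.
by rewrite /h !ler_pdivrMr // ler_pM2l // mulrC ler_pM2l.
Qed.

Lemma sqr_le_diagonal q : 0 < q -> (q ^+ 2 <= a ^+ 2 + b ^+ 2) = (q <= l).
Proof.
move=> q0; rewrite -diagonal_sqr ler_pXn2r ?nnegrE ?(ltW q0) //.
exact: ltW diagonal_gt0.
Qed.

Lemma sqr_ge_diagonal q : 0 < q -> (a ^+ 2 + b ^+ 2 <= q ^+ 2) = (l <= q).
Proof.
move=> q0; rewrite -diagonal_sqr ler_pXn2r ?nnegrE ?(ltW q0) //.
exact: ltW diagonal_gt0.
Qed.

(** As [h * l = a * b = p * q], comparing [p] with [h] is comparing [l] with [q]. *)
Lemma altitude_le_side p q : 0 < p -> p * q = a * b -> (h <= p) = (q <= l).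
Proof. by move=> p0 E; rewrite /h ler_pdivrMr ?diagonal_gt0 // -E ler_pM2l. Qed.

Lemma altitude_ge_side p q : 0 < p -> p * q = a * b -> (p <= h) = (l <= q).
Proof. by move=> p0 E; rewrite /h ler_pdivlMr ?diagonal_gt0 // -E ler_pM2l. Qed.

Lemma long_gt0 d : 0 < d -> 0 < a * b / d.
Proof. by move=> d0; rewrite divr_gt0 ?mulr_gt0. Qed.

Lemma long_area d : 0 < d -> d * (a * b / d) = a * b.
Proof. by move=> d0; rewrite mulrC divfK ?gt_eqF. Qed.

Lemma max_rectangles_push j : j \in [:: 0; 1; 2]%N ->
  max_area_rectangles (R_ a b 0 j) =
  [set S | exists d : R, 0 < d <= Num.min a b /\ rectangle (a * b / d) d S].
Proof.
move=> hj; have hj3 : (j <= 3)%N by move: hj; rewrite !inE => /or3P[] /eqP ->.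
apply/seteqP; split=> S.
  move=> /(max_area_rectanglesP S (leq0n 1) hj3)[mS [p [q [rS E]]]].
  have [p0 q0 _] := rS; have := short_side_le (leq0n 1) hj3 rS mS.
  have [_ le|_ le] := leP p q.
    by exists p; rewrite p0 le; split=> //; exact: rectangle_div rS.
  exists q; rewrite q0 le; split=> //.
  by apply: (@rectangle_div _ p); [rewrite mulrC|exact: rectangleC].
move=> [d [/andP[d0]]]; rewrite le_min => /andP[da db] rS.
have [s1 Ed El] := short_side_sin d0 db.
apply/(max_area_rectanglesP S (leq0n 1) hj3); split.
  exact: (push_can_move a0 b0 s1 Ed El da hj (rectangleC rS)).
by exists d, (a * b / d); split; [exact: rectangleC|exact: long_area].
Qed.

Lemma max_rectangles_hang :
  max_area_rectangles (R_ a b 0 3) =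
  [set S | exists d : R, h <= d <= Num.min a b /\ rectangle (a * b / d) d S].
Proof.
apply/seteqP; split=> S.
  move=> /(max_area_rectanglesP S (leq0n 1) (leqnn 3))[mS [p [q [rS E]]]].
  have [p0 q0 _] := rS; have := short_side_le (leq0n 1) (leqnn 3) rS mS.
  have E' : q * p = a * b by rewrite mulrC.
  have [x [c [s mot]]] := can_move_motion a0 (leq0n 1) (leqnn 3) rS mS.
  have [pl ql] : p <= l /\ q <= l.
    rewrite -!sqr_le_diagonal //.
    have [tau [cro|cro]] := last_crossing p0 q0 mot; have [ht EM _ _] := cro.
      split; last exact: (crossing_band a0 b0 p0 q0 mot cro).
      exact: (touching_small_p b0 p0 mot ht (crossing_p p0 q0 mot cro)).
    split; first exact: (crossing_band a0 b0 q0 p0 (motionC mot) cro).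
    exact: (touching_small_p b0 q0 (motionC mot) ht
      (crossing_p q0 p0 (motionC mot) cro)).
  have [_ le|_ le] := leP p q.
    exists p; rewrite le (altitude_le_side p0 E) ql.
    by split=> //; exact: rectangle_div rS.
  exists q; rewrite le (altitude_le_side q0 E') pl; split=> //.
  by apply: (@rectangle_div _ p); [rewrite mulrC|exact: rectangleC].
move=> [d [/andP[hd]]]; rewrite le_min => /andP[da db] rS.
have d0 : 0 < d := lt_le_trans altitude_gt0 hd.
have [s1 Ed El] := short_side_sin d0 db.
apply/(max_area_rectanglesP S (leq0n 1) (leqnn 3)); split.
  apply: (hang_can_move a0 b0 s1 Ed El da (leqnn 3) _ (rectangleC rS)).
  by rewrite sqr_le_diagonal ?long_gt0 // -(altitude_le_side d0 (long_area d0)).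
by exists d, (a * b / d); split; [exact: rectangleC|exact: long_area].
Qed.

Lemma max_translate i j S : (i <= 1)%N -> (j <= 3)%N -> rectangle a b S ->
  max_area_rectangles (R_ a b i j) S.
Proof.
move=> hi hj rS; apply/(max_area_rectanglesP S hi hj); split.
  exact: translate_can_move.
by exists a, b.
Qed.

Lemma max_rectangles_slip j : j \in [:: 0; 2]%N ->
  max_area_rectangles (R_ a b 1 j) =
  [set S | rectangle a b S \/
           exists d : R, 0 < d <= h /\ rectangle (a * b / d) d S].
Proof.
move=> hj; have hj3 : (j <= 3)%N by move: hj; rewrite !inE => /orP[] /eqP ->.
apply/seteqP; split=> S.
  move=> /(max_area_rectanglesP S (leqnn 1) hj3)[mS [p [q [rS E]]]].
  have [p0 q0 _] := rS; have E' : q * p = a * b by rewrite mulrC.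
  have [x [c [s mot]]] := can_move_motion a0 (leqnn 1) hj3 rS mS.
  have [[pE qE]|[pE qE]|lq|lp] := first_entering a0 b0 p0 q0 mot isT E.
  - by left; rewrite pE qE in rS; exact: rectangleC.
  - by left; rewrite pE qE in rS.
  - right; exists p; rewrite p0 (altitude_ge_side p0 E) -sqr_ge_diagonal //.
    by split=> //; exact: rectangle_div rS.
  right; exists q; rewrite q0 (altitude_ge_side q0 E') -sqr_ge_diagonal //.
  by split=> //; apply: (rectangle_div E'); exact: rectangleC.
case=> [rS|[d [/andP[d0 dh] rS]]]; first exact: max_translate.
have [ha hb] := altitude_le; have da := le_trans dh ha; have db := le_trans dh hb.
have [s1 Ed El] := short_side_sin d0 db.
apply/(max_area_rectanglesP S (leqnn 1) hj3); split.
  apply: (slip_can_move a0 b0 s1 Ed El da hj _ (rectangleC rS)).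
  by rewrite sqr_ge_diagonal ?long_gt0 // -(altitude_ge_side d0 (long_area d0)).
by exists d, (a * b / d); split; [exact: rectangleC|exact: long_area].
Qed.

Lemma max_rectangles_lean j : j \in [:: 1; 3]%N ->
  max_area_rectangles (R_ a b 1 j) =
  [set S | rectangle a b S \/ rectangle l h S].
Proof.
move=> hj; have hj3 : (j <= 3)%N by move: hj; rewrite !inE => /orP[] /eqP ->.
have jD : odd j by move: hj; rewrite !inE => /orP[] /eqP ->.
have l0 := diagonal_gt0.
apply/seteqP; split=> S.
  move=> /(max_area_rectanglesP S (leqnn 1) hj3)[mS [p [q [rS E]]]].
  have [p0 q0 _] := rS; have E' : q * p = a * b by rewrite mulrC.
  have [x [c [s mot]]] := can_move_motion a0 (leqnn 1) hj3 rS mS.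
  (* The floor on both sides bounds the sides above by [l], and [first_entering] bounds one of them
     below by [l], so only [l] and [h] remain besides [a] and [b]. *)
  have small : [\/ p = b /\ q = a, p = a /\ q = b | p <= l /\ q <= l].
    rewrite -!sqr_le_diagonal //.
    have [tau [cro|cro]] := last_crossing p0 q0 mot; have [ht EM _ _] := cro.
      have pl := touching_small_p b0 p0 mot ht (crossing_p p0 q0 mot cro).
      have [?|ql] := crossing_below a0 b0 p0 q0 mot cro isT jD E.
        by constructor 1.
      by constructor 3.
    have ql := touching_small_p b0 q0 (motionC mot) ht
      (crossing_p q0 p0 (motionC mot) cro).
    have [[? ?]|pl] := crossing_below a0 b0 q0 p0 (motionC mot) cro isT jD E'.
      by constructor 2.
    by constructor 3.
  case: small => [[pE qE]|[pE qE]|[pl ql]].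
  - by left; rewrite pE qE in rS; exact: rectangleC.
  - by left; rewrite pE qE in rS.
  have [[pE qE]|[pE qE]|lq|lp] := first_entering a0 b0 p0 q0 mot isT E.
  - by left; rewrite pE qE in rS; exact: rectangleC.
  - by left; rewrite pE qE in rS.
  - right; have qE : q = l.
      by apply/eqP; rewrite eq_le ql -sqr_ge_diagonal.
    by rewrite /h -qE -E mulfK ?gt_eqF //; exact: rectangleC.
  right; have pE : p = l.
    by apply/eqP; rewrite eq_le pl -sqr_ge_diagonal.
  by rewrite /h -pE -E' mulfK ?gt_eqF.
case=> [rS|rS]; first exact: max_translate.
have [ha hb] := altitude_le; have h0 := altitude_gt0.
have [s1 Ed El] := short_side_sin h0 hb.
have lE : a * b / h = l by rewrite /h; field; rewrite !gt_eqF.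
rewrite lE in El.
apply/(max_area_rectanglesP S (leqnn 1) hj3); split.
  exact: (lean_can_move a0 b0 s1 Ed El ha hj3 diagonal_sqr (rectangleC rS)).
by exists l, h; split=> //; rewrite -lE divfK ?gt_eqF.
Qed.

End MaximalRectangles.

Theorem corollary3 (R : realType) (a b : R) (ha : 0 < a) (hb : 0 < b) :
  let l := Num.sqrt (a ^+ 2 + b ^+ 2) in
  let h := a * b / l in
  (forall i j : nat, (i <= 1)%N -> (j <= 3)%N ->
     is_max_area (R_ a b i j) (a * b)) /\
  (forall j : nat, j \in [:: 0; 1; 2]%N ->
     max_area_rectangles (R_ a b 0 j) =
     [set S | exists d : R, 0 < d <= Num.min a b /\ rectangle (a * b / d) d S]) /\
  (max_area_rectangles (R_ a b 0 3) =
     [set S | exists d : R, h <= d <= Num.min a b /\ rectangle (a * b / d) d S]) /\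
  (forall j : nat, j \in [:: 0; 2]%N ->
     max_area_rectangles (R_ a b 1 j) =
     [set S | rectangle a b S \/
              exists d : R, 0 < d <= h /\ rectangle (a * b / d) d S]) /\
  (forall j : nat, j \in [:: 1; 3]%N ->
     max_area_rectangles (R_ a b 1 j) =
     [set S | rectangle a b S \/ rectangle l h S]).
Proof.
move=> l h; split; first by move=> i j; exact: max_area_corner.
split; first exact: max_rectangles_push.
split; first exact: max_rectangles_hang.
split; first exact: max_rectangles_slip.
exact: max_rectangles_lean.
Qed.
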